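(* Let $Q$ be a quiver, and let $L$ be the complex vector space of cyclic paths in the double quiver $\overline{Q}$, equipped with the necklace bracket $\mathrm{br}=\{\cdot,\cdot\}: L\otimes L\to L$ (which is a Lie bracket) and the linear map $\delta: L\to L\wedge L$ defined in the context. Then $(L,\mathrm{br},\delta)$ is a Lie bialgebra. That is, $\delta$ satisfies the co-Jacobi identity $$\mathrm{Alt}\circ(\delta\otimes 1)\circ\delta=0,\qquad \mathrm{Alt}(e\otimes f\otimes g)=e\otimes f\otimes g+f\otimes g\otimes e+g\otimes e\otimes f,$$ and the cocycle condition: for all $e,f\in L$, $$\delta\{e,f\}=\{\delta(e),\,1\otimes f+f\otimes 1\}+\{1\otimes e+e\otimes 1,\,\delta(f)\},$$ where $\{x\otimes y,\,1\otimes f+f\otimes 1\}=x\otimes\{y,f\}+\{x,f\}\otimes y$ and $\{1\otimes e+e\otimes 1,\,x\otimes y\}=x\otimes\{e,y\}+\{e,x\}\otimes y$.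
   Context: $Q$ is a quiver with vertex set $I$ (loops and multiple edges allowed); $Q$ also denotes its set of edges. Each edge $e$ has source $e_s\in I$ and target $e_t\in I$. The double quiver $\overline{Q}$ has vertex set $I$ and edges $\{e,e^*\mid e\in Q\}$ with $e^*_s=e_t$, $e^*_t=e_s$; put $(e^* )^*=e$. Let $B=\mathbb{C}^I$ (direct sum of copies of $\mathbb{C}$ indexed by $I$, vertices being viewed as idempotents), let $A_Q$ be the path algebra of $\overline{Q}$ over $\mathbb{C}$ (the product of two paths is their concatenation, written left to right, if the target of the first is the source of the second, and zero otherwise; vertices are the trivial paths), and let $L=A_Q/[A_Q,A_Q]$, where $[A_Q,A_Q]$ is the span of all commutators. Thus $L$ has a basis consisting of the vertices $v\in I$ and the closed paths $a_1\cdots a_k$ ($k\ge1$, $a_i\in\overline{Q}$) of $\overline{Q}$ taken up to cyclic rotation. For $f,g\in\overline{Q}$ define the number $[f,g]$ by $[e,e^*]=1$ and $[e^*,e]=-1$ for $e\in Q$, and $[f,g]=0$ if $f\ne g^*$. Bracket: for closed paths $a_1\cdots a_k$ and $b_1\cdots b_l$ with $k,l\geq 1$, $$\{a_1\cdots a_k,b_1\cdots b_l\}=\sum_{1\le i\le k,\,1\le j\le l}[a_i,b_j]\,(a_i)_t\,a_{i+1}\cdots a_k a_1\cdots a_{i-1}\,b_{j+1}\cdots b_l b_1\cdots b_{j-1},$$ and $\{b,x\}=\{x,b\}=0$ for $b\in B$, $x\in L$. (The vertex $(a_i)_t$ matters only when the remaining word is empty, in which case the word is the idempotent $(a_i)_t$.)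 Cobracket: $\delta$ is linear, $\delta(v)=0$ for vertices $v$, $\delta(a)=0$ for closed paths of length one, and for $k\ge2$ $$\delta(a_1\cdots a_k)=\sum_{1\le i<j\le k}[a_i,a_j]\,\bigl((a_j)_t\,a_{j+1}\cdots a_k a_1\cdots a_{i-1}\bigr)\wedge\bigl((a_i)_t\,a_{i+1}\cdots a_{j-1}\bigr),$$ where $P\wedge R:=P\otimes R-R\otimes P$. *)

(* Defs.v *)
From HB Require Import structures.
From mathcomp Require Import all_boot all_order all_algebra.
From mathcomp Require Import finmap boolp classical_sets reals complex.
From mathcomp Require Import monalg.

Set Implicit Arguments.
Unset Strict Implicit.
Unset Printing Implicit Defensive.

Import GRing.Theory.
Local Open Scope ring_scope.
Local Open Scope quotient_scope.

(* The linear extension of f to the free vector space on T. *)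
HB.lock Definition mlift (K : fieldType) (T : choiceType) (W : lmodType K)
  (f : T -> W) (x : {malg K[T]}) : W := \sum_(k <- msupp x) x@_k *: f k.

Section FreeLift.
Variables (K : fieldType) (T : choiceType) (W : lmodType K).
Implicit Types (f : T -> W) (x y : {malg K[T]}).

Lemma mliftEw f x (D : {fset T}) :
  (msupp x `<=` D)%fset -> mlift f x = \sum_(k <- D) x@_k *: f k.
Proof.
move=> sxD; rewrite mlift.unlock; apply: big_fset_incl => // k _ kx.
by rewrite mcoeff_outdom // scale0r.
Qed.

Lemma mliftU f k : mlift f << k >> = f k.
Proof.
by rewrite (mliftEw f (msuppU_le)) big_seq_fset1 mcoeffUU scale1r.
Qed.

Lemma mlift_is_linear f : linear (mlift f).
Proof.
move=> a x y; pose D := (msupp x `|` msupp y)%fset.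
rewrite (@mliftEw f x D) ?fsubsetUl // (@mliftEw f y D) ?fsubsetUr //.
rewrite (@mliftEw f _ D); last first.
  apply: (fsubset_trans (msuppD_le _ _)); apply: fsetUSS => //.
  exact: msuppZ_le.
rewrite scaler_sumr -big_split /=; apply: eq_bigr => k _.
by rewrite mcoeffD mcoeffZ scalerDl scalerA.
Qed.

HB.instance Definition _ f :=
  GRing.isLinear.Build K {malg K[T]} W *:%R (mlift f) (mlift_is_linear f).

Lemma malg_ext (g h : {linear {malg K[T]} -> W}) :
  (forall k, g << k >> = h << k >>) -> g =1 h.
Proof.
move=> gh x; rewrite (monalgE x) !linear_sum; apply: eq_bigr => k _.
have -> : << x@_k *g k >> = x@_k *: << k >>.
  by apply/malgP => j; rewrite mcoeffZ !mcoeffU mulrnAr mulr1.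
by rewrite (linearZ_LR g) (linearZ_LR h) gh.
Qed.

Lemma mlift_eq (g h : {malg K[T]} -> W) :
  linear g -> linear h -> (forall k, g << k >> = h << k >>) -> g =1 h.
Proof.
move=> gL hL; pose g' : {linear {malg K[T]} -> W} :=
  HB.pack g (GRing.isLinear.Build K {malg K[T]} W *:%R g gL).
pose h' : {linear {malg K[T]} -> W} :=
  HB.pack h (GRing.isLinear.Build K {malg K[T]} W *:%R h hL).
exact: (@malg_ext g' h').
Qed.

Lemma mlift0 x : mlift (fun=> 0 : W) x = 0.
Proof. by rewrite mlift.unlock big1 // => k _; rewrite scaler0. Qed.

Lemma mlift_funP (a : K) f g x :
  mlift (fun k => a *: f k + g k) x = a *: mlift f x + mlift g x.
Proof.
rewrite mlift.unlock scaler_sumr -big_split; apply: eq_bigr => k _ /=.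
by rewrite scalerDr !scalerA mulrC.
Qed.

End FreeLift.

Lemma mliftC (K : fieldType) (T T' : choiceType) (W : lmodType K)
    (F : T -> T' -> W) x y :
  mlift (fun p => mlift (F p) y) x = mlift (fun q => mlift (F^~ q) x) y.
Proof.
move: x; apply: mlift_eq => [|a u v|p]; first exact: mlift_is_linear.
  under eq_fun do rewrite mlift_is_linear.
  by rewrite mlift_funP.
by rewrite mliftU; under [in RHS]eq_fun do rewrite mliftU.
Qed.

Section Span.
Variables (K : fieldType) (V : lmodType K) (S : set V).

Inductive span : V -> Prop :=
| span0 : span 0
| spanD (a : K) (x y : V) : S x -> span y -> span (a *: x + y).

Lemma span_add x y : span x -> span y -> span (x + y).
Proof.
by move=> sx sy; elim: sx => [|a u v Su _ sv]; rewrite ?add0r // -addrA; constructor.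
Qed.

Lemma span_scale a x : span x -> span (a *: x).
Proof.
elim=> [|b u v Su _ sv]; first by rewrite scaler0; constructor.
by rewrite scalerDr scalerA; constructor.
Qed.

Lemma span_incl x : S x -> span x.
Proof. by move=> Sx; rewrite -[x]addr0 -[x]scale1r; apply: spanD Sx span0. Qed.

End Span.

(* A quotient of V by the subspace spanned by S. *)
Record quotient (K : fieldType) (V : lmodType K) (S : set V) := Quotient {
  quotient_sort : lmodType K;
  quotient_pi : {linear V -> quotient_sort};
  quotient_surj : forall X, exists x, X = quotient_pi x;
  quotient_ker : forall x, quotient_pi x = 0 <-> span S x }.

Module QuotientConstruction.
Section QuotientConstruction.
Variables (K : fieldType) (V : lmodType K) (S : set V).
Local Notation span := (span S).

Definition rquot_rel (x y : V) : bool := `[< span (x - y) >].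

Lemma rquot_rel_equiv : equiv_class_of rquot_rel.
Proof.
split=> [x|x y|y x z].
- by apply/asboolP; rewrite subrr; constructor.
- by apply/asbool_equiv_eq; split=> /(span_scale (-1)); rewrite scaleN1r opprB.
move=> /asboolP sxy /asboolP syz; apply/asboolP.
by rewrite -[x](subrK y) -addrA; exact: span_add.
Qed.

Canonical rquot_equiv := EquivRelPack rquot_rel_equiv.

Definition rquot := {eq_quot rquot_rel}.

HB.instance Definition _ := Choice.on rquot.
HB.instance Definition _ : EqQuotient V rquot_rel rquot := EqQuotient.on rquot.

Definition rpi (x : V) : rquot := \pi_rquot x.

Lemma rpiP x y : rpi x = rpi y <-> span (x - y).
Proof. by split=> [/eqquotP/asboolP //|sxy]; apply/eqquotP/asboolP. Qed.

Lemma rpi_repr (X : rquot) : rpi (repr X) = X.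
Proof. exact: reprK. Qed.

Lemma rpi_surj (X : rquot) : exists x, X = rpi x.
Proof. by exists (repr X); rewrite rpi_repr. Qed.

Lemma repr_rpi x : span (repr (rpi x) - x).
Proof. by apply/rpiP; rewrite rpi_repr. Qed.

Definition rquot_add (X Y : rquot) : rquot := rpi (repr X + repr Y).
Definition rquot_opp (X : rquot) : rquot := rpi (- repr X).
Definition rquot_scale (a : K) (X : rquot) : rquot := rpi (a *: repr X).

Lemma rquot_addE x y : rquot_add (rpi x) (rpi y) = rpi (x + y).
Proof.
apply/rpiP; rewrite opprD addrACA.
by apply: span_add; exact: repr_rpi.
Qed.

Lemma rquot_oppE x : rquot_opp (rpi x) = rpi (- x).
Proof.
by apply/rpiP; rewrite -opprD -[- (_ - x)]scaleN1r; apply: span_scale; exact: repr_rpi.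
Qed.

Lemma rquot_scaleE a x : rquot_scale a (rpi x) = rpi (a *: x).
Proof. by apply/rpiP; rewrite -scalerBr; apply: span_scale; exact: repr_rpi. Qed.

Lemma rquot_addA : associative rquot_add.
Proof.
move=> X Y Z; rewrite -[X]rpi_repr -[Y]rpi_repr -[Z]rpi_repr.
by rewrite !rquot_addE addrA.
Qed.

Lemma rquot_addC : commutative rquot_add.
Proof.
by move=> X Y; rewrite -[X]rpi_repr -[Y]rpi_repr !rquot_addE addrC.
Qed.

Lemma rquot_add0 : left_id (rpi 0) rquot_add.
Proof. by move=> X; rewrite -[X]rpi_repr rquot_addE add0r. Qed.

Lemma rquot_addN : left_inverse (rpi 0) rquot_opp rquot_add.
Proof. by move=> X; rewrite -[X]rpi_repr rquot_oppE rquot_addE addNr. Qed.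

HB.instance Definition _ :=
  GRing.isZmodule.Build rquot rquot_addA rquot_addC rquot_add0 rquot_addN.

Lemma rquot_scaleA a b X : rquot_scale a (rquot_scale b X) = rquot_scale (a * b) X.
Proof. by rewrite -[X]rpi_repr !rquot_scaleE scalerA. Qed.

Lemma rquot_scale1 : left_id 1 rquot_scale.
Proof. by move=> X; rewrite -[X]rpi_repr rquot_scaleE scale1r. Qed.

Lemma rquot_scaleDr : right_distributive rquot_scale rquot_add.
Proof.
move=> a X Y; have [x ->] := rpi_surj X; have [y ->] := rpi_surj Y.
by rewrite !(rquot_addE, rquot_scaleE) scalerDr.
Qed.

Lemma rquot_scaleDl X a b :
  rquot_scale (a + b) X = rquot_add (rquot_scale a X) (rquot_scale b X).
Proof.
by have [x ->] := rpi_surj X; rewrite !rquot_scaleE rquot_addE scalerDl.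
Qed.

HB.instance Definition _ := GRing.Zmodule_isLmodule.Build K rquot
  rquot_scaleA rquot_scale1 rquot_scaleDr rquot_scaleDl.

Lemma rpi_is_linear : linear rpi.
Proof. by move=> a x y; rewrite -rquot_addE -rquot_scaleE. Qed.

HB.instance Definition _ :=
  GRing.isLinear.Build K V rquot *:%R rpi rpi_is_linear.

Lemma rpi_ker x : rpi x = 0 <-> span x.
Proof.
by rewrite -[X in _ <-> span X]subr0 -rpiP (linear0 rpi).
Qed.

Definition main : quotient S := Quotient rpi_surj rpi_ker.

End QuotientConstruction.
End QuotientConstruction.

(* Opaque: only the defining properties of a quotient are ever used. *)
Fact quotient_exists (K : fieldType) (V : lmodType K) (S : set V) : quotient S.
Proof. exact: QuotientConstruction.main. Qed.

Section LinearQuotient.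
Variables (K : fieldType) (V : lmodType K) (S : set V).

Definition lquot : lmodType K := quotient_sort (quotient_exists S).

Definition lpi : {linear V -> lquot} := quotient_pi (quotient_exists S).

Lemma lpi_surj (X : lquot) : exists x, X = lpi x.
Proof. exact: quotient_surj. Qed.

Lemma lpi_ker x : lpi x = 0 <-> span S x.
Proof. exact: quotient_ker. Qed.

Lemma lpi0 x : S x -> lpi x = 0.
Proof. by move=> /span_incl/lpi_ker. Qed.

End LinearQuotient.

(* The map induced by f; meaningful when f is linear and kills S, see
   lquot_liftE. *)
HB.lock Definition lquot_lift (K : fieldType) (V : lmodType K) (S : set V)
  (W : lmodType K) (f : V -> W) (X : lquot S) : W :=
  f (sval (cid (lpi_surj X))).

Section LinearQuotientLift.
Variables (K : fieldType) (V : lmodType K) (S : set V).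
Variables (W : lmodType K) (f : V -> W).

Hypotheses (f_lin : linear f) (f_kills : forall x, S x -> f x = 0).

Let fL : {linear V -> W} :=
  HB.pack f (GRing.isLinear.Build K V W *:%R f f_lin).

Lemma lquot_liftE x : lquot_lift f (lpi S x) = f x.
Proof.
have f_span y : span S y -> fL y = 0.
  elim=> [|a u v Su _ fv]; first by rewrite linear0.
  by rewrite linearP fv addr0 [fL u]f_kills // scaler0.
rewrite lquot_lift.unlock; case: cid => y /= xy.
apply/eqP; rewrite eq_sym -subr_eq0 -[f]/(fL : V -> W) -linearB /=.
by apply/eqP/f_span/lpi_ker; rewrite linearB /= xy subrr.
Qed.

Lemma lquot_lift_is_linear : linear (lquot_lift (S := S) f).
Proof.
move=> a X Y; have [x ->] := lpi_surj X; have [y ->] := lpi_surj Y.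
by rewrite -linearP !lquot_liftE f_lin.
Qed.

End LinearQuotientLift.

Section Tensor.
Variables (K : fieldType) (U V : lmodType K).

Local Notation F := {malg K[(U * V)%type]}.

(* The relations defining the tensor product as a quotient of the free space on
   U * V. *)
Definition tensor_rel : set F := fun z =>
  (exists a u u' v,
    z = << (a *: u + u', v) >> - (a *: << (u, v) >> + << (u', v) >>)) \/
  (exists a u v v',
    z = << (u, a *: v + v') >> - (a *: << (u, v) >> + << (u, v') >>)).

Definition tensor : lmodType K := lquot tensor_rel.

End Tensor.

HB.lock Definition tpure (K : fieldType) (U V : lmodType K) (u : U) (v : V) :
  tensor U V := lpi (@tensor_rel K U V) << (u, v) >>.

Section TensorTheory.
Variables (K : fieldType) (U V : lmodType K).
Local Notation tensor := (tensor U V).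
Local Notation tensor_rel := (@tensor_rel K U V).

Lemma tpure_linearl (v : V) : linear (fun u : U => tpure u v).
Proof.
move=> a u u'; apply/eqP; rewrite -subr_eq0 tpure.unlock -linearP -linearB /=.
by apply/eqP/lpi0; left; exists a, u, u', v.
Qed.

Lemma tpure_linearr (u : U) : linear (fun v : V => tpure u v).
Proof.
move=> a v v'; apply/eqP; rewrite -subr_eq0 tpure.unlock -linearP -linearB /=.
by apply/eqP/lpi0; right; exists a, u, v, v'.
Qed.

Lemma tensor_ext (W : lmodType K) (g h : {linear tensor -> W}) :
  (forall (u : U) (v : V), g (tpure u v) = h (tpure u v)) -> g =1 h.
Proof.
move=> gh t; have [x ->] := lpi_surj t.
apply: (malg_ext (g := g \o lpi tensor_rel) (h := h \o lpi tensor_rel)) => -[u v].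
by have := gh u v; rewrite tpure.unlock.
Qed.

Lemma tensor_eq (W : lmodType K) (g h : tensor -> W) :
  linear g -> linear h ->
  (forall (u : U) (v : V), g (tpure u v) = h (tpure u v)) -> g =1 h.
Proof.
move=> gL hL; pose g' : {linear tensor -> W} :=
  HB.pack g (GRing.isLinear.Build K tensor W *:%R g gL).
pose h' : {linear tensor -> W} :=
  HB.pack h (GRing.isLinear.Build K tensor W *:%R h hL).
exact: (@tensor_ext W g' h').
Qed.

End TensorTheory.

(* The map induced by f; meaningful when f is bilinear, see tliftE. *)
HB.lock Definition tlift (K : fieldType) (U V W : lmodType K) (f : U -> V -> W)
  : tensor U V -> W :=
  lquot_lift (mlift (fun p : U * V => f p.1 p.2)).

Definition bilinear_map (K : fieldType) (U V W : lmodType K) (f : U -> V -> W) :=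
  (forall v, linear (f^~ v)) /\ (forall u, linear (f u)).

Section TensorLift.
Variables (K : fieldType) (U V W : lmodType K) (f : U -> V -> W).
Hypothesis f_bilin : bilinear_map f.

Let f' := mlift (fun p : U * V => f p.1 p.2).

Fact tlift_kills z : tensor_rel z -> f' z = 0.
Proof.
rewrite {}/f'; case=> -[a [u [v [w ->]]]]; rewrite linearB linearP /= !mliftU /=.
  by rewrite (f_bilin.1 w a u v) subrr.
by rewrite (f_bilin.2 u a v w) subrr.
Qed.

Lemma tliftE u v : tlift f (tpure u v) = f u v.
Proof.
rewrite tlift.unlock tpure.unlock lquot_liftE ?mliftU //; first exact: mlift_is_linear.
exact: tlift_kills.
Qed.

Lemma tlift_linear : linear (tlift f).
Proof.
rewrite tlift.unlock; apply: lquot_lift_is_linear; last exact: tlift_kills.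
exact: mlift_is_linear.
Qed.

End TensorLift.

Notation "u \ox v" := (tpure u v) (at level 40, left associativity) : ring_scope.

Section TensorMap.
Variables (K : fieldType) (U V U' V' : lmodType K).
Variables (f : {linear U -> U'}) (g : {linear V -> V'}).

(* f \otimes g *)
Definition tmap : tensor U V -> tensor U' V' := tlift (fun u v => f u \ox g v).

Fact tmap_bilinear : bilinear_map (fun u v => f u \ox g v).
Proof.
split=> [v a u u'|u a v v']; rewrite linearP.
  exact: tpure_linearl.
exact: tpure_linearr.
Qed.

HB.instance Definition _ :=
  GRing.isLinear.Build K (tensor U V) (tensor U' V') *:%R tmap
    (tlift_linear tmap_bilinear).

Lemma tmapE u v : tmap (u \ox v) = f u \ox g v.
Proof. exact: (tliftE tmap_bilinear). Qed.

End TensorMap.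

Section Alt.
Variables (K : fieldType) (V : lmodType K).

Local Notation V2 := (tensor V V).
Local Notation V3 := (tensor V2 V).

Definition rot3_fun (z x y : V) : V3 := y \ox z \ox x.

Fact rot3_fun_bilinear z : bilinear_map (rot3_fun z).
Proof.
split=> [y a x x'|x a y y']; rewrite /rot3_fun; first exact: tpure_linearr.
by rewrite [_ \ox z]tpure_linearl [LHS]tpure_linearl.
Qed.

Fact rot3_bilinear : bilinear_map (fun t z => tlift (rot3_fun z) t).
Proof.
split=> [z|t a z z']; first exact: tlift_linear (rot3_fun_bilinear z).
have hL w : linear (tlift (rot3_fun w)) := tlift_linear (rot3_fun_bilinear w).
move: t; apply: tensor_eq => [|b s t|x y]; first exact: hL.
  by rewrite !hL !scalerDr addrACA !scalerA mulrC.
rewrite (tliftE (rot3_fun_bilinear (_ + _))) (tliftE (rot3_fun_bilinear z)).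
rewrite (tliftE (rot3_fun_bilinear z')) /rot3_fun.
by rewrite [y \ox _]tpure_linearr [LHS]tpure_linearl.
Qed.

(* x \otimes y \otimes z |-> y \otimes z \otimes x *)
Definition rot3 : V3 -> V3 := tlift (fun t z => tlift (rot3_fun z) t).

HB.instance Definition _ :=
  GRing.isLinear.Build K V3 V3 *:%R rot3 (tlift_linear rot3_bilinear).

Lemma rot3E x y z : rot3 (x \ox y \ox z) = y \ox z \ox x.
Proof.
by rewrite /rot3 (tliftE rot3_bilinear) (tliftE (rot3_fun_bilinear _)).
Qed.

Definition Alt (t : V3) : V3 := t + rot3 t + rot3 (rot3 t).

Lemma AltE x y z :
  Alt (x \ox y \ox z) = x \ox y \ox z + y \ox z \ox x + z \ox x \ox y.
Proof. by rewrite /Alt !rot3E. Qed.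

End Alt.

Section LieBialgebra.
Variables (K : fieldType) (V : lmodType K).

Definition wedge (x y : V) : tensor V V := x \ox y - y \ox x.

Variables (br : {linear tensor V V -> V}) (delta : {linear V -> tensor V V}).

(* {x, -} and {-, y} *)
Definition lie_l (x y : V) : V := br (x \ox y).
Definition lie_r (y x : V) : V := br (x \ox y).

Fact lie_l_linear x : linear (lie_l x).
Proof. by move=> a y z; rewrite /lie_l tpure_linearr linearP. Qed.

Fact lie_r_linear x : linear (lie_r x).
Proof. by move=> a y z; rewrite /lie_r tpure_linearl linearP. Qed.

HB.instance Definition _ x :=
  GRing.isLinear.Build K V V *:%R (lie_l x) (lie_l_linear x).
HB.instance Definition _ x :=
  GRing.isLinear.Build K V V *:%R (lie_r x) (lie_r_linear x).

(* {t, 1 \otimes y + y \otimes 1} *)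
Definition act_r (t : tensor V V) (y : V) : tensor V V :=
  tmap idfun (lie_r y) t + tmap (lie_r y) idfun t.

(* {1 \otimes x + x \otimes 1, t} *)
Definition act_l (x : V) (t : tensor V V) : tensor V V :=
  tmap idfun (lie_l x) t + tmap (lie_l x) idfun t.

Lemma act_rE x y z : act_r (x \ox y) z = x \ox br (y \ox z) + br (x \ox z) \ox y.
Proof. by rewrite /act_r !tmapE. Qed.

Lemma act_lE x y z : act_l z (x \ox y) = x \ox br (z \ox y) + br (z \ox x) \ox y.
Proof. by rewrite /act_l !tmapE. Qed.

Record lie_bracket : Prop := LieBracket {
  lie_alternating : forall x, br (x \ox x) = 0;
  lie_jacobi : forall x y z,
    br (x \ox br (y \ox z)) + br (y \ox br (z \ox x))
      + br (z \ox br (x \ox y)) = 0 }.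

Record lie_bialgebra : Prop := LieBialgebra {
  lie_bialgebra_bracket : lie_bracket;
  (* delta takes its values in the subspace V /\ V of V \otimes V *)
  lie_bialgebra_wedge : forall x,
    span [set t | exists y z, t = wedge y z] (delta x);
  lie_bialgebra_cojacobi : forall x, Alt (tmap delta idfun (delta x)) = 0;
  lie_bialgebra_cocycle : forall x y,
    delta (br (x \ox y)) = act_r (delta x) y + act_l x (delta y) }.

End LieBialgebra.

(* The vertex and arrow types are arbitrary, in particular possibly infinite. *)
Record quiver := Quiver {
  vertex : choiceType;
  arrow : choiceType;
  arrow_src : arrow -> vertex;
  arrow_tgt : arrow -> vertex }.

Section DoubleQuiver.
Variable Q : quiver.

(* Edges of the double quiver: inl e is e and inr e is e^*. *)
Definition edge : choiceType := (arrow Q + arrow Q)%type.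

Definition edge_src (a : edge) : vertex Q :=
  match a with inl e => arrow_src e | inr e => arrow_tgt e end.

Definition edge_tgt (a : edge) : vertex Q :=
  match a with inl e => arrow_tgt e | inr e => arrow_src e end.

(* The number [a, b]. *)
Definition edge_pairing (R : pzRingType) (a b : edge) : R :=
  match a, b with
  | inl e, inr f => (e == f)%:R
  | inr e, inl f => - (e == f)%:R
  | _, _ => 0
  end.

Fixpoint is_walk (v : vertex Q) (w : seq edge) : bool :=
  if w is a :: w' then (edge_src a == v) && is_walk (edge_tgt a) w' else true.

(* A path is a starting vertex followed by consecutive edges; the trivial path
   at v is (v, [::]). *)
Definition qpath : choiceType := {p : vertex Q * seq edge | is_walk p.1 p.2}.

Definition path_src (p : qpath) : vertex Q := (val p).1.
Definition path_word (p : qpath) : seq edge := (val p).2.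
Definition path_tgt (p : qpath) : vertex Q :=
  last (path_src p) (map edge_tgt (path_word p)).
Definition closed_path (p : qpath) : bool := path_tgt p == path_src p.

End DoubleQuiver.

Section NecklaceSpace.
Variables (K : fieldType) (Q : quiver).

(* The underlying space of the path algebra. It has no unit when there are
   infinitely many vertices, hence is not declared as a ring. *)
Definition path_alg : lmodType K := {malg K[qpath Q]}.

(* The product v a_1 ... a_n in the path algebra, zero if it is not a path. *)
Definition walk (v : vertex Q) (w : seq (edge Q)) : path_alg :=
  if insub (v, w) is Some p then << p >> else 0.

Definition qpath_mul (p q : qpath Q) : path_alg :=
  if path_tgt p == path_src q
  then walk (path_src p) (path_word p ++ path_word q) else 0.

Definition path_mul (x y : path_alg) : path_alg :=
  mlift (fun p => mlift (qpath_mul p) y) x.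

Definition path_comm : set path_alg :=
  [set z | exists x y, z = path_mul x y - path_mul y x].

(* L = A / [A, A] *)
Definition necklaces : lmodType K := lquot path_comm.

(* The class of v a_1 ... a_n in L. *)
Definition cyc (v : vertex Q) (w : seq (edge Q)) : necklaces :=
  lpi path_comm (walk v w).

Local Notation "''[' a , b ]" := (edge_pairing K a b).

Definition word_bracket (a b : seq (edge Q)) : necklaces :=
  \sum_(i < size a) \sum_(j < size b)
    let ai := tnth (in_tuple a) i in let bj := tnth (in_tuple b) j in
    '[ai, bj] *: cyc (edge_tgt ai)
      (drop i.+1 a ++ take i a ++ drop j.+1 b ++ take j b).

Definition word_cobracket (a : seq (edge Q)) : tensor necklaces necklaces :=
  \sum_(i < size a) \sum_(j < size a | (i < j)%N)
    let ai := tnth (in_tuple a) i in let aj := tnth (in_tuple a) j in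
    '[ai, aj] *: wedge (cyc (edge_tgt aj) (drop j.+1 a ++ take i a))
                       (cyc (edge_tgt ai) (drop i.+1 (take j a))).

(* The formulas apply to closed paths only; the other paths vanish in L. *)
Definition path_bracket (p q : qpath Q) : necklaces :=
  if closed_path p && closed_path q
  then word_bracket (path_word p) (path_word q) else 0.

Definition path_cobracket (p : qpath Q) : tensor necklaces necklaces :=
  if closed_path p then word_cobracket (path_word p) else 0.

Definition alg_bracket (x y : path_alg) : necklaces :=
  mlift (fun p => mlift (path_bracket p) y) x.

Definition bracket_fun (X Y : necklaces) : necklaces :=
  lquot_lift (fun x => lquot_lift (alg_bracket x) Y) X.

Definition bracket : tensor necklaces necklaces -> necklaces :=
  tlift bracket_fun.

Definition cobracket : necklaces -> tensor necklaces necklaces :=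
  lquot_lift (mlift path_cobracket).

End NecklaceSpace.

Lemma is_walk_cat Q (v : vertex Q) w1 w2 :
  is_walk v (w1 ++ w2) =
  is_walk v w1 && is_walk (last v (map (@edge_tgt Q) w1)) w2.
Proof. by elim: w1 v => //= a w1 IH v; rewrite IH andbA. Qed.

Section Trace.
Variables (K : fieldType) (Q : quiver) (W : lmodType K).

Lemma walk_qpath (p : qpath Q) : walk K (path_src p) (path_word p) = << p >>.
Proof. by rewrite /walk /path_src /path_word -surjective_pairing valK. Qed.

Lemma walkE (v : vertex Q) w : is_walk v w ->
  exists p : qpath Q, [/\ walk K v w = << p >>, path_src p = v & path_word p = w].
Proof.
move=> vw; pose p : qpath Q := exist _ (v, w) vw.
by exists p; rewrite -[v]/(path_src p) -[w]/(path_word p) walk_qpath.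
Qed.

Lemma qpath_mulE (p q : qpath Q) : path_tgt p = path_src q ->
  exists r : qpath Q, [/\ qpath_mul K p q = << r >>, path_src r = path_src p,
    path_tgt r = path_tgt q & path_word r = path_word p ++ path_word q].
Proof.
move=> pq; rewrite /qpath_mul pq eqxx.
have [|r [-> rs rw]] := @walkE (path_src p) (path_word p ++ path_word q).
  rewrite is_walk_cat; apply/andP; split; first exact: (valP p).
  by rewrite -/(path_tgt p) pq; exact: (valP q).
exists r; split=> //; rewrite /path_tgt rs rw map_cat last_cat.
by rewrite -/(path_tgt p) pq.
Qed.

Variables (g : qpath Q -> W) (h : seq (edge Q) -> W).
Hypothesis gE : forall p, g p = if closed_path p then h (path_word p) else 0.
Hypothesis hC : forall w1 w2, h (w1 ++ w2) = h (w2 ++ w1).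

Fact mlift_qpath_mul (p q : qpath Q) :
  mlift g (qpath_mul K p q) =
  if (path_tgt p == path_src q) && (path_tgt q == path_src p)
  then h (path_word p ++ path_word q) else 0.
Proof.
have [pq|pq] := eqVneq (path_tgt p) (path_src q); last first.
  by rewrite /qpath_mul (negPf pq) linear0.
have [r [-> rs rt rw]] := qpath_mulE pq.
by rewrite mliftU gE /closed_path rs rt rw.
Qed.

Lemma mlift_path_comm z : @path_comm K Q z -> mlift g z = 0.
Proof.
case=> x [y ->]; apply/eqP; rewrite linearB /= subr_eq0; apply/eqP.
pose G1 x y := mlift (fun p => mlift (fun q => mlift g (qpath_mul K p q)) y) x.
have G1E x' y' : mlift g (path_mul x' y') = G1 x' y'.
  rewrite /path_mul /G1; move: x'; apply: mlift_eq => [||p].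
  - by move=> a u v; rewrite mlift_is_linear linearP.
  - exact: mlift_is_linear.
  rewrite !mliftU; move: y'; apply: mlift_eq => [||q].
  - by move=> a u v; rewrite mlift_is_linear linearP.
  - exact: mlift_is_linear.
  by rewrite !mliftU.
rewrite !G1E /G1 [RHS]mliftC; congr mlift; apply/funext => p.
congr (mlift _ y); apply/funext => q.
by rewrite !mlift_qpath_mul andbC hC.
Qed.

End Trace.

Lemma edge_pairingC Q (R : pzRingType) (a b : edge Q) :
  edge_pairing R a b = - edge_pairing R b a.
Proof. by case: a b => [e|e] [f|f] /=; rewrite ?oppr0 ?opprK // eq_sym. Qed.

Section Rotation.
Variables (T : Type) (W : zmodType).

Lemma sum_tnth_nth (x0 : T) (s : seq T) (G : nat -> T -> W) :
  \sum_(i < size s) G i (tnth (in_tuple s) i) =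
  \sum_(i < size s) G i (nth x0 s i).
Proof. by apply: eq_bigr => i _; rewrite (tnth_nth x0). Qed.

Lemma sum_rot (F : T -> seq T -> W) s1 s2 :
  let S s := \sum_(i < size s)
    F (tnth (in_tuple s) i) (drop i.+1 s ++ take i s) in
  S (s1 ++ s2) = S (s2 ++ s1).
Proof.
move=> S; suff SE s t : S (s ++ t) =
    \sum_(i < size s) F (tnth (in_tuple s) i) (drop i.+1 s ++ t ++ take i s) +
    \sum_(i < size t) F (tnth (in_tuple t) i) (drop i.+1 t ++ s ++ take i t).
  by rewrite !SE addrC.
have [/size0nil ->|] := posnP (size s).
  rewrite big_ord0 add0r /S /=.
  by apply: eq_bigr.
case: s => // x0 s; move: {s}(x0 :: s) => s _.
rewrite /S (sum_tnth_nth x0 (s ++ t)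
  (fun i a => F a (drop i.+1 (s ++ t) ++ take i (s ++ t)))).
rewrite size_cat big_split_ord; congr +%R; apply: eq_bigr => i _ /=.
  rewrite (tnth_nth x0) nth_cat ltn_ord drop_cat take_cat ltn_ord.
  case: ltnP => [_|si]; first by rewrite -catA.
  have -> : i.+1 = size s by apply/eqP; rewrite eqn_leq si ltn_ord.
  by rewrite subnn drop0 drop_size.
rewrite (tnth_nth x0) nth_cat take_cat [(_ + i < _)%N]ltnNge leq_addr /=.
by rewrite -addnS drop_cat ltnNge leq_addr !addKn.
Qed.

Lemma sum_pairs_rot (C : T -> T -> seq T -> seq T -> W) s1 s2 :
  (forall a b u v, C a b u v = C b a v u) ->
  let S s := \sum_(i < size s) \sum_(j < size s | (i < j)%N)
    C (tnth (in_tuple s) i) (tnth (in_tuple s) j)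
      (drop j.+1 s ++ take i s) (drop i.+1 (take j s)) in
  S (s1 ++ s2) = S (s2 ++ s1).
Proof.
move=> CC S.
case: s1 => [|x0 s1]; first by rewrite cats0.
move: {s1}(x0 :: s1) => s1.
pose D s t := \sum_(i < size s) \sum_(j < size s | (i < j)%N)
  C (nth x0 s i) (nth x0 s j) (drop j.+1 s ++ t ++ take i s)
    (drop i.+1 (take j s)).
pose X s t := \sum_(i < size s) \sum_(j < size t)
  C (nth x0 s i) (nth x0 t j) (drop j.+1 t ++ take i s)
    (drop i.+1 s ++ take j t).
suff SE s t : S (s ++ t) = D s t + X s t + D t s.
  have XC s t : X s t = X t s.
    rewrite /X exchange_big; apply: eq_bigr => j _; apply: eq_bigr => i _.
    exact: CC.
  by rewrite !SE XC addrAC [RHS]addrAC [D s1 s2 + _]addrC.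
transitivity (\sum_(i < size (s ++ t)) \sum_(j < size (s ++ t))
  if (i < j)%N then C (nth x0 (s ++ t) i) (nth x0 (s ++ t) j)
    (drop j.+1 (s ++ t) ++ take i (s ++ t))
    (drop i.+1 (take j (s ++ t))) else 0).
  apply: eq_bigr => i _; rewrite big_mkcond; apply: eq_bigr => j _.
  by rewrite !(tnth_nth x0).
have drop_s (i : 'I_(size s)) u : drop i.+1 (s ++ u) = drop i.+1 s ++ u.
  rewrite drop_cat; case: ltnP => [//|si].
  have -> : i.+1 = size s by apply/eqP; rewrite eqn_leq si ltn_ord.
  by rewrite subnn drop0 drop_size.
have drop_t k u v : drop (size u + k).+1 (u ++ v) = drop k.+1 v :> seq T.
  by rewrite -addnS drop_cat ltnNge leq_addr addKn.
have take_t k u v : take (size u + k) (u ++ v) = u ++ take k v :> seq T.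
  by rewrite take_cat ltnNge leq_addr addKn.
rewrite size_cat big_split_ord; congr +%R.
  rewrite -big_split /=; apply: eq_bigr => i _.
  rewrite big_split_ord; congr +%R.
    rewrite [RHS]big_mkcond; apply: eq_bigr => j _ /=; case: ifP => // ij.
    by rewrite !nth_cat !ltn_ord drop_s !takel_cat 1?ltnW // -?catA.
  apply: eq_bigr => j _ /=.
  rewrite (leq_trans (ltn_ord i)) ?leq_addr // !nth_cat ltn_ord.
  rewrite [(_ + j < _)%N]ltnNge leq_addr /= addKn takel_cat 1?ltnW //.
  by rewrite drop_t take_t drop_s.
apply: eq_bigr => i _; rewrite big_split_ord /= big1 ?add0r => [|j _]; last first.
  by rewrite ltnNge ltnW // (leq_trans (ltn_ord j)) ?leq_addr.
rewrite [RHS]big_mkcond; apply: eq_bigr => j _ /=; rewrite ltn_add2l.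
case: ifP => // ij; rewrite !nth_cat ![(size s + _ < _)%N]ltnNge !leq_addr /=.
rewrite !addKn.
by rewrite !take_t !drop_t.
Qed.

End Rotation.

Section Necklace.
Variables (K : fieldType) (Q : quiver).
Local Notation L := (necklaces K Q).

Lemma word_bracketCl a1 a2 (b : seq (edge Q)) :
  word_bracket K (a1 ++ a2) b = word_bracket K (a2 ++ a1) b.
Proof.
pose F a (u : seq (edge Q)) : L := \sum_(j < size b)
  let bj := tnth (in_tuple b) j in edge_pairing K a bj *:
    cyc K (edge_tgt a) (u ++ drop j.+1 b ++ take j b).
have FE a : word_bracket K a b = \sum_(i < size a)
    F (tnth (in_tuple a) i) (drop i.+1 a ++ take i a).
  by apply: eq_bigr => i _; apply: eq_bigr => j _; rewrite -catA.
rewrite !FE; exact: sum_rot.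
Qed.

Lemma word_bracketCr (a : seq (edge Q)) b1 b2 :
  word_bracket K a (b1 ++ b2) = word_bracket K a (b2 ++ b1).
Proof.
apply: eq_bigr => i _ /=; pose ai := tnth (in_tuple a) i.
exact: (sum_rot (fun bj u => edge_pairing K ai bj *:
  cyc K (edge_tgt ai) (drop i.+1 a ++ take i a ++ u))).
Qed.

Lemma word_cobracketC (a1 a2 : seq (edge Q)) :
  word_cobracket K (a1 ++ a2) = word_cobracket K (a2 ++ a1).
Proof.
apply: (sum_pairs_rot (C := fun a b u v => edge_pairing K a b *:
  wedge (cyc K (edge_tgt b) u) (cyc K (edge_tgt a) v))) => a b u v.
by rewrite edge_pairingC scaleNr -scalerN /wedge opprB.
Qed.

Fact alg_bracket_linearl y : linear (fun x => @alg_bracket K Q x y).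
Proof. exact: mlift_is_linear. Qed.

Fact alg_bracket_linearr x : linear (@alg_bracket K Q x).
Proof.
move=> a y z; rewrite /alg_bracket -mlift_funP; congr (mlift _ x).
by apply/funext => p; exact: mlift_is_linear.
Qed.

Fact alg_bracket_killsl y z : @path_comm K Q z -> alg_bracket z y = 0.
Proof.
apply: (mlift_path_comm (h := fun w => mlift (fun q =>
  if closed_path q then word_bracket K w (path_word q) else 0) y)) => [p|w1 w2].
  rewrite /path_bracket; case: (closed_path p) => //=.
  exact: mlift0.
by congr (mlift _ y); apply/funext => q; rewrite word_bracketCl.
Qed.

Fact alg_bracket_killsr x z : @path_comm K Q z -> alg_bracket x z = 0.
Proof.
move=> cz; rewrite /alg_bracket -[RHS](mlift0 L x).
congr (mlift _ x); apply/funext => p.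
apply: (mlift_path_comm (h := fun w =>
  if closed_path p then word_bracket K (path_word p) w else 0)) cz => [q|w1 w2].
  by rewrite /path_bracket; do 2!case: (closed_path _).
by rewrite word_bracketCr.
Qed.

Fact bracket_fun_lpi x y :
  bracket_fun (lpi (@path_comm K Q) x) (lpi (@path_comm K Q) y) =
  alg_bracket x y.
Proof.
have E x' Y : lquot_lift (alg_bracket x') (lpi (@path_comm K Q) Y) =
    alg_bracket x' Y.
  apply: lquot_liftE; first exact: alg_bracket_linearr.
  exact: alg_bracket_killsr.
rewrite /bracket_fun lquot_liftE ?E // => [a u v|z cz]; rewrite !E.
  exact: alg_bracket_linearl.
exact: alg_bracket_killsl.
Qed.

Fact bracket_bilinear : bilinear_map (@bracket_fun K Q).
Proof.
split=> [Y a X X'|X a Y Y'].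
  have [x ->] := lpi_surj X; have [x' ->] := lpi_surj X'.
  have [y ->] := lpi_surj Y.
  by rewrite -linearP !bracket_fun_lpi alg_bracket_linearl.
have [x ->] := lpi_surj X; have [y ->] := lpi_surj Y.
have [y' ->] := lpi_surj Y'.
by rewrite -linearP !bracket_fun_lpi alg_bracket_linearr.
Qed.

HB.instance Definition _ := GRing.isLinear.Build K (tensor L L) L *:%R
  (@bracket K Q) (tlift_linear bracket_bilinear).

Fact cobracket_kills z :
  @path_comm K Q z -> mlift (@path_cobracket K Q) z = 0.
Proof.
exact: (mlift_path_comm (h := @word_cobracket K Q) _ word_cobracketC).
Qed.

Fact cobracket_linear : linear (@cobracket K Q).
Proof.
apply: lquot_lift_is_linear; last exact: cobracket_kills.
exact: mlift_is_linear.
Qed.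

HB.instance Definition _ := GRing.isLinear.Build K L (tensor L L) *:%R
  (@cobracket K Q) cobracket_linear.

(* bracketE and cobracketE below are the defining formulas. A vertex is
   cyc K v [::], for which the sums are empty. *)
Definition closed_walk (v : vertex Q) (w : seq (edge Q)) : bool :=
  is_walk v w && (last v (map (@edge_tgt Q) w) == v).

Lemma closed_walkE v w : closed_walk v w ->
  exists p : qpath Q,
    [/\ walk K v w = << p >>, closed_path p & path_word p = w].
Proof.
case/andP=> vw vv; have [p [-> ps pw]] := walkE K vw.
by exists p; split; rewrite // /closed_path /path_tgt ps pw.
Qed.

Lemma bracketE v a u b : closed_walk v a -> closed_walk u b ->
  bracket (cyc K v a \ox cyc K u b) = word_bracket K a b.
Proof.
move=> /closed_walkE[p [ap pc pw]] /closed_walkE[q [bq qc qw]].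
rewrite /bracket (tliftE bracket_bilinear) /cyc bracket_fun_lpi ap bq /alg_bracket.
by rewrite !mliftU /path_bracket pc qc /= pw qw.
Qed.

Lemma cobracketE v a : closed_walk v a ->
  cobracket (cyc K v a) = word_cobracket K a.
Proof.
move=> /closed_walkE[p [ap pc pw]]; rewrite /cobracket /cyc lquot_liftE.
- by rewrite ap mliftU /path_cobracket pc pw.
- exact: mlift_is_linear.
exact: cobracket_kills.
Qed.

End Necklace.

(* Main.v *)
(* Words are taken over an enlarged alphabet: the edges of the double quiver
   together with its vertices, seen as idempotents.  A cyclic word is sent to its
   class in L, or to 0 if it is not composable.  If the target of the removed
   letter is inserted at both cuts of the bracket (and of the cobracket), the
   defining formulas hold for arbitrary words, composable or not:
     {a, b} = sum over x in a, y in b of [x, y] (x_t A y_t B),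
     delta a = sum over x <> y in a of [x, y] (y_t q) (x) (x_t p),
   where a = x A, b = y B, respectively a = x p y q, up to rotation.  All the axioms
   then follow from the invariance of cyclic words under rotation, the
   antisymmetry of the pairing, and the vanishing of the pairing on vertices:
   each axiom expands into sums over points of cyclic words, which cancel after
   exchanging the names of the points. *)
From HB Require Import structures.
Require Import Defs.
From mathcomp Require Import all_boot all_algebra.
From mathcomp Require Import reals complex.
From mathcomp Require Import monalg.

Set Implicit Arguments.
Unset Strict Implicit.
Unset Printing Implicit Defensive.

Import GRing.Theory.
Local Open Scope ring_scope.

(** * Sums over the positions of a letter in a word *)

Fixpoint splits (T : Type) (w : seq T) : seq (seq T * T * seq T) :=
  if w is x :: w' then
    ([::], x, w') :: [seq (x :: s.1.1, s.1.2, s.2) | s <- splits w']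
  else [::].

(** Positions are listed through a recursion on the word, not indexed by numbers, so that identities
    between such sums follow by induction on the word. *)
Definition split_sum (T : Type) (W : nmodType) (F : seq T -> T -> seq T -> W)
  (w : seq T) : W := \sum_(s <- splits w) F s.1.1 s.1.2 s.2.

Notation "\split_ ( u , x , v <- w ) E" := (split_sum (fun u x v => E) w)
  (at level 41, E at level 41, u name, x name, v name, w at level 60,
   format "'[' \split_ ( u ,  x ,  v  <-  w ) '/  '  E ']'").

Section SplitSum.
Variables (T : Type) (W : nmodType).
Implicit Types (F G : seq T -> T -> seq T -> W) (u v w : seq T).

(** The summand receives the equation [w = u ++ x :: v], so that a condition on the whole word can
    be carried into each term. *)
Lemma eq_split F G w :
  (forall u x v, w = u ++ x :: v -> F u x v = G u x v) ->
  split_sum F w = split_sum G w.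
Proof.
rewrite /split_sum; elim: w F G => [|a w IH] F G FG; first by rewrite !big_nil.
rewrite !big_cons !big_map /= FG //; congr (_ + _).
by apply: (IH (fun u => F (a :: u)) (fun u => G (a :: u))) => u x v wE;
  apply: FG; rewrite wE.
Qed.

Lemma split_nil F : split_sum F [::] = 0.
Proof. exact: big_nil. Qed.

Lemma split_cons F a w :
  split_sum F (a :: w) = F [::] a w + \split_(u, x, v <- w) F (a :: u) x v.
Proof. by rewrite /split_sum big_cons big_map. Qed.

Lemma split_add F G w :
  \split_(u, x, v <- w) (F u x v + G u x v) = split_sum F w + split_sum G w.
Proof. exact: big_split. Qed.

Lemma split_cat F w1 w2 :
  split_sum F (w1 ++ w2) =
  \split_(u, x, v <- w1) F u x (v ++ w2) + \split_(u, x, v <- w2) F (w1 ++ u) x v.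
Proof.
elim: w1 F => [|a w1 IH] F; first by rewrite split_nil add0r.
by rewrite cat_cons !split_cons IH addrA.
Qed.

(** Both sides run over the pairs of positions x before y in [w = u ++ x :: p ++ y :: q]; the left
    side picks x first, the right side y first. *)
Lemma split_nest (F : seq T -> T -> seq T -> T -> seq T -> W) w :
  \split_(u, x, v <- w) \split_(p, y, q <- v) F u x p y q =
  \split_(v, y, q <- w) \split_(u, x, p <- v) F u x p y q.
Proof.
elim: w F => [|a w IH] F; first by rewrite !split_nil.
rewrite !split_cons split_nil add0r IH -split_add.
by apply: eq_split => u x v _; rewrite split_cons.
Qed.

Lemma split_exchange (T' : Type)
    (F : seq T -> T -> seq T -> seq T' -> T' -> seq T' -> W) w (w' : seq T') :
  \split_(u, x, v <- w) \split_(u', x', v' <- w') F u x v u' x' v' =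
  \split_(u', x', v' <- w') \split_(u, x, v <- w) F u x v u' x' v'.
Proof. exact: exchange_big. Qed.

End SplitSum.

Lemma split_sub (T : Type) (W : zmodType) (F G : seq T -> T -> seq T -> W) w :
  \split_(u, x, v <- w) (F u x v - G u x v) = split_sum F w - split_sum G w.
Proof. exact: sumrB. Qed.

Lemma linear_split (T : Type) (K : fieldType) (W W' : lmodType K)
    (f : {linear W -> W'}) (F : seq T -> T -> seq T -> W) w :
  f (split_sum F w) = \split_(u, x, v <- w) f (F u x v).
Proof. exact: linear_sum. Qed.

(* [cyclic_sum F w] runs over the letters x of the cyclic word w, A being the
   rest of the word read from x; [cyclic_sum2 G w] runs over the ordered pairs
   (x, y) of distinct positions, p and q being the arcs from x to y and from y
   to x. *)
Definition cyclic_sum (T : Type) (W : nmodType) (F : T -> seq T -> W) w : W :=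
  \split_(u, x, v <- w) F x (v ++ u).

Definition cyclic_sum2 (T : Type) (W : nmodType)
  (G : T -> seq T -> T -> seq T -> W) w : W :=
  cyclic_sum (fun x A => \split_(p, y, q <- A) G x p y q) w.

(** * Renaming and regrouping of points on cyclic words *)

Section CyclicSum.
Variables (T : Type) (W : nmodType).
Implicit Types (F : T -> seq T -> W) (G : T -> seq T -> T -> seq T -> W).

Lemma eq_cyclic F F' w : (forall x A, F x A = F' x A) ->
  cyclic_sum F w = cyclic_sum F' w.
Proof. by move=> FF; apply: eq_split => u x v _. Qed.

Lemma eq_cyclic2 G G' w : (forall x p y q, G x p y q = G' x p y q) ->
  cyclic_sum2 G w = cyclic_sum2 G' w.
Proof. by move=> GG; apply: eq_cyclic => x A; apply: eq_split => u y v _. Qed.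

Lemma cyclic0 F w : (forall x A, F x A = 0) -> cyclic_sum F w = 0.
Proof. by move=> F0; apply: big1 => s _; rewrite F0. Qed.

Lemma cyclic_add F F' w :
  cyclic_sum (fun x A => F x A + F' x A) w = cyclic_sum F w + cyclic_sum F' w.
Proof. exact: split_add. Qed.

Lemma cyclic2_add G G' w :
  cyclic_sum2 (fun x p y q => G x p y q + G' x p y q) w =
  cyclic_sum2 G w + cyclic_sum2 G' w.
Proof. by rewrite -cyclic_add; apply: eq_cyclic => x A; exact: split_add. Qed.

Lemma cyclic_exchange (T' : Type) (F : T -> seq T -> T' -> seq T' -> W) w w' :
  cyclic_sum (fun x A => cyclic_sum (F x A) w') w =
  cyclic_sum (fun y B => cyclic_sum (fun x A => F x A y B) w) w'.
Proof. exact: split_exchange. Qed.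

Lemma cyclic_split_exchange (T' : Type)
    (F : T -> seq T -> seq T' -> T' -> seq T' -> W) w (w' : seq T') :
  cyclic_sum (fun x A => \split_(u, y, v <- w') F x A u y v) w =
  \split_(u, y, v <- w') cyclic_sum (fun x A => F x A u y v) w.
Proof. exact: split_exchange. Qed.

(** Here and below, the letters on which the summand vanishes stand for the vertex letters inserted
    by a contraction: they pair to zero with every letter. *)
Lemma cyclic_cons F a w : (forall A, F a A = 0) ->
  cyclic_sum F (a :: w) = \split_(u, x, v <- w) F x (v ++ a :: u).
Proof. by move=> F0; rewrite /cyclic_sum split_cons F0 add0r. Qed.

Lemma cyclic_cons2 F a w b w' : (forall A, F a A = 0) -> (forall A, F b A = 0) ->
  cyclic_sum F (a :: w ++ b :: w') =
  \split_(u, x, v <- w) F x (v ++ b :: w' ++ a :: u) +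
  \split_(u, x, v <- w') F x (v ++ a :: w ++ b :: u).
Proof.
move=> Fa Fb; rewrite cyclic_cons // split_cat split_cons Fb add0r.
by congr (_ + _); apply: eq_split => u x v _; rewrite -?catA.
Qed.

(** Two distinct positions of the linear word occur in both orders on the cyclic word; the arc that
    leaves the later one wraps around as [q ++ u]. *)
Lemma cyclic2E G w : cyclic_sum2 G w =
  \split_(u, x, v <- w) \split_(p, y, q <- v)
    (G x p y (q ++ u) + G y (q ++ u) x p).
Proof.
pose H u x p y q : W := G y (q ++ u) x p.
transitivity (\split_(u, x, v <- w) \split_(p, y, q <- v) G x p y (q ++ u) +
              \split_(u, x, v <- w) \split_(p, y, q <- v) H u x p y q).
  rewrite (split_nest H) -split_add; apply: eq_split => u x v _.
  exact: split_cat.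
by rewrite -split_add; apply: eq_split => u x v _; rewrite -split_add.
Qed.

Lemma cyclic2_swap G w :
  cyclic_sum2 G w = cyclic_sum2 (fun x p y q => G y q x p) w.
Proof.
by rewrite !cyclic2E; do 2![apply: eq_split => ? ? ? _]; rewrite addrC.
Qed.

Lemma cyclic2_cons G a w :
  (forall p y q, G a p y q = 0) -> (forall x p q, G x p a q = 0) ->
  cyclic_sum2 G (a :: w) =
  \split_(u, x, v <- w) \split_(p, y, q <- v)
    (G x p y (q ++ a :: u) + G y (q ++ a :: u) x p).
Proof.
move=> Ga Gb; rewrite cyclic2E split_cons [X in X + _]big1 ?add0r // => s _.
by rewrite Ga Gb addr0.
Qed.

(** The three sums collect the pairs with both points in [w], both in [w'], and one in each. *)
Lemma cyclic2_cons2 G a w b w' :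
  (forall p y q, G a p y q = 0) -> (forall x p q, G x p a q = 0) ->
  (forall p y q, G b p y q = 0) -> (forall x p q, G x p b q = 0) ->
  cyclic_sum2 G (a :: w ++ b :: w') =
  \split_(u, x, v <- w) \split_(p, y, q <- v)
    (G x p y (q ++ b :: w' ++ a :: u) + G y (q ++ b :: w' ++ a :: u) x p) +
  \split_(u, x, v <- w') \split_(p, y, q <- v)
    (G x p y (q ++ a :: w ++ b :: u) + G y (q ++ a :: w ++ b :: u) x p) +
  \split_(u, x, v <- w) \split_(u', y, v' <- w')
    (G x (v ++ b :: u') y (v' ++ a :: u) + G y (v' ++ a :: u) x (v ++ b :: u')).
Proof.
move=> Ga Ga' Gb Gb'; rewrite cyclic2_cons // split_cat split_cons.
rewrite [X in _ + (X + _)]big1 ?add0r => [|s _]; last by rewrite Gb Gb' addr0.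
rewrite addrAC; congr (_ + _); rewrite -split_add; apply: eq_split => u x v _.
rewrite split_cat split_cons Gb Gb' addr0 add0r.
by congr (_ + _); apply: eq_split => p y q _; rewrite -?catA.
Qed.

(** Three points in cyclic order, with the arcs between them, can be enumerated from x or from y. *)
Lemma cyclic3_rot (F : T -> seq T -> T -> seq T -> T -> seq T -> W) w :
  cyclic_sum2 (fun x p y B => \split_(q, z, r <- B) F x p y q z r) w =
  cyclic_sum2 (fun y q z B => \split_(r, x, p <- B) F x p y q z r) w.
Proof.
rewrite cyclic2_swap; apply: eq_cyclic => x A; symmetry.
exact: (split_nest (fun q z r x' p => F x' p x q z r)).
Qed.

(** Four points in cyclic order are enumerated from the first or from the third of them. *)
Lemma cyclic4_rot
    (F : T -> seq T -> T -> seq T -> T -> seq T -> T -> seq T -> W) w :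
  cyclic_sum2 (fun x p y B => \split_(q, z, C <- B)
    \split_(r, t, s <- C) F x p y q z r t s) w =
  cyclic_sum2 (fun x p y B => \split_(q, z, C <- B)
    \split_(r, t, s <- C) F z r t s x p y q) w.
Proof.
(* Choosing the first and third points at the start leaves two independent arcs, one for each
   remaining point; the rotation is then an exchange of the two chosen points. *)
have SE (H : T -> seq T -> T -> seq T -> T -> seq T -> T -> seq T -> W) :
    cyclic_sum2 (fun x p y B => \split_(q, z, C <- B)
      \split_(r, t, s <- C) H x p y q z r t s) w =
    cyclic_sum2 (fun x A z C => \split_(p, y, q <- A)
      \split_(r, t, s <- C) H x p y q z r t s) w.
  apply: eq_cyclic => x A.
  exact: (split_nest (fun p y q z C => \split_(r, t, s <- C) H x p y q z r t s)).
rewrite SE (SE (fun x p y q z r t s => F z r t s x p y q)) cyclic2_swap.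
by apply: eq_cyclic2 => x A z C; exact: split_exchange.
Qed.

End CyclicSum.

Lemma linear_cyclic (T : Type) (K : fieldType) (W W' : lmodType K)
    (f : {linear W -> W'}) (F : T -> seq T -> W) w :
  f (cyclic_sum F w) = cyclic_sum (fun x A => f (F x A)) w.
Proof. exact: linear_sum. Qed.

Lemma linear_cyclic2 (T : Type) (K : fieldType) (W W' : lmodType K)
    (f : {linear W -> W'}) (G : T -> seq T -> T -> seq T -> W) w :
  f (cyclic_sum2 G w) = cyclic_sum2 (fun x p y q => f (G x p y q)) w.
Proof.
by rewrite linear_cyclic; apply: eq_cyclic => x A; exact: linear_split.
Qed.

Section Scale.
Variables (T : Type) (K : fieldType) (W : lmodType K).

Lemma split_scale (c : K) (F : seq T -> T -> seq T -> W) w :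
  c *: split_sum F w = \split_(u, x, v <- w) c *: F u x v.
Proof. exact: scaler_sumr. Qed.

Lemma cyclic_scale (c : K) (F : T -> seq T -> W) w :
  c *: cyclic_sum F w = cyclic_sum (fun x A => c *: F x A) w.
Proof. exact: scaler_sumr. Qed.

Lemma cyclic2_scale (c : K) (G : T -> seq T -> T -> seq T -> W) w :
  c *: cyclic_sum2 G w = cyclic_sum2 (fun x p y q => c *: G x p y q) w.
Proof.
by rewrite cyclic_scale; apply: eq_cyclic => x A; exact: split_scale.
Qed.

Lemma cyclic_sub (F F' : T -> seq T -> W) w :
  cyclic_sum (fun x A => F x A - F' x A) w = cyclic_sum F w - cyclic_sum F' w.
Proof. exact: split_sub. Qed.

Lemma cyclic2_sub (G G' : T -> seq T -> T -> seq T -> W) w :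
  cyclic_sum2 (fun x p y q => G x p y q - G' x p y q) w =
  cyclic_sum2 G w - cyclic_sum2 G' w.
Proof. by rewrite -cyclic_sub; apply: eq_cyclic => x A; exact: split_sub. Qed.

End Scale.

Lemma cyclic_exchange2 (T T' : Type) (W : nmodType)
    (F : T -> seq T -> T' -> seq T' -> T' -> seq T' -> W) w w' :
  cyclic_sum (fun x A => cyclic_sum2 (F x A) w') w =
  cyclic_sum2 (fun y p z q => cyclic_sum (fun x A => F x A y p z q) w) w'.
Proof.
rewrite cyclic_exchange; apply: eq_cyclic => y B.
exact: cyclic_split_exchange.
Qed.

(** * Linearity of the tensor operations in each argument *)

Section TensorPure.
Variables (K : fieldType) (U V : lmodType K).

Definition tpurel (v : V) (u : U) : tensor U V := u \ox v.

HB.instance Definition _ v :=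
  GRing.isLinear.Build K U (tensor U V) *:%R (tpurel v) (tpure_linearl v).

End TensorPure.

Section TensorLinear.
Variables (K : fieldType) (V : lmodType K).

Definition wedgel (y x : V) : tensor V V := wedge x y.

Fact wedgel_linear y : linear (wedgel y).
Proof.
move=> a u v; rewrite /wedgel /wedge tpure_linearl tpure_linearr.
by rewrite scalerBr opprD addrACA.
Qed.

HB.instance Definition _ y :=
  GRing.isLinear.Build K V (tensor V V) *:%R (wedgel y) (wedgel_linear y).

Lemma wedge0l x : wedge 0 x = 0 :> tensor V V.
Proof. exact: (linear0 (wedgel x)). Qed.

Lemma wedge0r x : wedge x 0 = 0 :> tensor V V.
Proof. by apply: oppr_inj; rewrite opprB oppr0; exact: wedge0l. Qed.

Fact Alt_linear : linear (@Alt K V).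
Proof.
move=> a s t; rewrite /Alt !linearP !scalerDr.
by rewrite [X in X + _ = _]addrACA [LHS]addrACA.
Qed.

HB.instance Definition _ :=
  GRing.isLinear.Build K (tensor (tensor V V) V) (tensor (tensor V V) V) *:%R
    (@Alt K V) Alt_linear.

Variables (br : {linear tensor V V -> V}).

Definition act_rl (y : V) (t : tensor V V) : tensor V V := act_r br t y.

Fact act_rl_linear y : linear (act_rl y).
Proof. by move=> a s t; rewrite /act_rl /act_r !linearP scalerDr addrACA. Qed.

Fact act_l_linearr x : linear (act_l br x).
Proof. by move=> a s t; rewrite /act_l !linearP scalerDr addrACA. Qed.

HB.instance Definition _ y :=
  GRing.isLinear.Build K (tensor V V) (tensor V V) *:%R (act_rl y)
    (act_rl_linear y).
HB.instance Definition _ x :=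
  GRing.isLinear.Build K (tensor V V) (tensor V V) *:%R (act_l br x)
    (act_l_linearr x).

Fact act_r_linear t : linear (act_r br t).
Proof.
move=> a y z; rewrite -!/(act_rl _ t).
apply: (tensor_ext (h := (a \*: act_rl y \+ act_rl z))) => u v /=.
rewrite /act_rl !act_rE -!/(lie_l br _ _) !linearP.
by rewrite tpure_linearl tpure_linearr scalerDr addrACA.
Qed.

Fact act_l_linear t : linear (fun x => act_l br x t).
Proof.
move=> a y z.
apply: (tensor_ext (h := (a \*: act_l br y \+ act_l br z))) => u v /=.
rewrite !act_lE -!/(lie_r br _ _) !linearP.
by rewrite tpure_linearl tpure_linearr scalerDr addrACA.
Qed.

End TensorLinear.

(** * Formal cyclic words with an antisymmetric pairing *)

Section FormalNecklaces.
Variables (K : fieldType) (V : lmodType K) (T : Type).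
Variables (pr : T -> T -> K) (vx : T -> T) (cy : seq T -> V).
Variables (br : {linear tensor V V -> V}) (delta : {linear V -> tensor V V}).

(* [cy w] is the class of the cyclic word w, and [vx x] is a letter standing for
   the target vertex of x. *)
Hypothesis prC : forall x y, pr x y = - pr y x.
Hypothesis pr_vx : forall x y, pr (vx x) y = 0.
Hypothesis cyC : forall u v, cy (u ++ v) = cy (v ++ u).
Hypothesis cy_span : forall X, Defs.span (fun c => exists w, c = cy w) X.
Hypothesis brE : forall a b, br (cy a \ox cy b) =
  cyclic_sum (fun x A => cyclic_sum (fun y B =>
    pr x y *: cy (vx x :: A ++ vx y :: B)) b) a.
Hypothesis deltaE : forall a, delta (cy a) =
  cyclic_sum2 (fun x p y q => pr x y *: (cy (vx y :: q) \ox cy (vx x :: p))) a.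

Lemma pr_vxr x y : pr x (vx y) = 0.
Proof. by rewrite prC pr_vx oppr0. Qed.

Lemma cy_swap x A y B : cy (x :: A ++ y :: B) = cy (y :: B ++ x :: A).
Proof. exact: (cyC (x :: A) (y :: B)). Qed.

(** As cyclic words span, an identity linear in each argument need only be checked on them. *)
Lemma cy_ext (W : lmodType K) (f g : V -> W) :
  linear f -> linear g -> (forall w, f (cy w) = g (cy w)) -> f =1 g.
Proof.
move=> fL gL fg X.
pose F : {linear V -> W} := HB.pack f (GRing.isLinear.Build K V W *:%R f fL).
pose G : {linear V -> W} := HB.pack g (GRing.isLinear.Build K V W *:%R g gL).
elim: (cy_span X) => [|a _ y [w ->] _ IH].
  by rewrite -[f 0]/(F 0) -[g 0]/(G 0) !linear0.
by rewrite fL gL fg IH.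
Qed.

(** * Antisymmetry and the Jacobi identity *)

Lemma br_antisym X Y : br (X \ox Y) = - br (Y \ox X).
Proof.
rewrite -scaleN1r.
move: X; apply: cy_ext => [|b X X'|a]; first exact: (lie_r_linear br Y).
  exact: (linearP (-1 \*: lie_l br Y)).
move: Y; apply: cy_ext => [|c Y Y'|b]; first exact: (lie_l_linear br (cy a)).
  exact: (linearP (-1 \*: lie_r br (cy a))).
(* Exchanging the names x and y rotates the resulting word and changes the sign of the pairing. *)
rewrite !brE cyclic_exchange cyclic_scale; apply: eq_cyclic => y B.
rewrite cyclic_scale; apply: eq_cyclic => x A.
by rewrite prC cy_swap scaleNr scaleN1r.
Qed.

(* The part of {a, {b, c}} where a is contracted with a letter of b; in
   [jacobi_r], with a letter of c. *)
Definition jacobi_l a b c : V := cyclic_sum (fun x A =>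
  cyclic_sum2 (fun z u y v => cyclic_sum (fun w C =>
    (pr x y * pr z w) *: cy (vx x :: A ++ vx y :: v ++ vx w :: C ++ vx z :: u))
  c) b) a.

Definition jacobi_r a b c : V := cyclic_sum (fun x A =>
  cyclic_sum (fun z B => cyclic_sum2 (fun w u y v =>
    (pr x y * pr z w) *: cy (vx x :: A ++ vx y :: v ++ vx z :: B ++ vx w :: u))
  c) b) a.

Lemma br_brE a b c :
  br (cy a \ox br (cy b \ox cy c)) = jacobi_l a b c + jacobi_r a b c.
Proof.
rewrite -/(lie_l br (cy a) _) brE linear_cyclic.
transitivity (cyclic_sum (fun x A => cyclic_sum (fun z B => cyclic_sum (fun w C =>
  pr z w *: cyclic_sum (fun y D => pr x y *: cy (vx x :: A ++ vx y :: D))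
     (vx z :: B ++ vx w :: C)) c) b) a).
  rewrite [RHS]cyclic_exchange; apply: eq_cyclic => z B.
  rewrite [RHS]cyclic_exchange linear_cyclic; apply: eq_cyclic => w C.
  by rewrite linearZ /= /lie_l brE linear_cyclic.
rewrite -cyclic_add; apply: eq_cyclic => x A.
rewrite -cyclic_add; apply: eq_cyclic => z B.
rewrite -cyclic_split_exchange -cyclic_add; apply: eq_cyclic => w C.
(* The inserted letters [vx z] and [vx w] contribute nothing, so y lies in B or in C: these are the
   two parts. *)
rewrite cyclic_cons2 => [|D|D]; rewrite ?pr_vxr ?scale0r // scalerDr !split_scale.
by congr (_ + _); apply: eq_split => ? ? ? _; rewrite scalerA mulrC.
Qed.

(** In both terms [b] is contracted with [a] and with [c] at two distinct letters. The resulting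
    words agree up to rotation, and the contraction of [b] with [c] is read in opposite orders,
    whence the sign. *)
Lemma jacobi_cancel a b c : jacobi_r c a b = - jacobi_l a b c.
Proof.
rewrite -scaleN1r /jacobi_r cyclic_exchange cyclic_scale; apply: eq_cyclic => x A.
rewrite cyclic_exchange2 cyclic2_swap cyclic2_scale; apply: eq_cyclic2 => z u y v.
rewrite cyclic_scale; apply: eq_cyclic => w C.
rewrite scalerA (prC w z) mulN1r mulNr mulrC; congr (_ *: _).
by have := cyC (vx w :: C ++ vx z :: u) (vx x :: A ++ vx y :: v); rewrite /= -!catA.
Qed.

Lemma br_jacobi X Y Z :
  br (X \ox br (Y \ox Z)) + br (Y \ox br (Z \ox X)) + br (Z \ox br (X \ox Y)) = 0.
Proof.
have zero_linear : linear (fun=> 0 : V).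
  by move=> k U U'; rewrite scaler0 addr0.
pose f (U : V) := lie_r br U; pose g (U : V) := lie_l br U.
move: X; apply: cy_ext => [||a] //.
  exact: (linearP (f (br (Y \ox Z)) \+ (g Y \o g Z) \+ (g Z \o f Y))).
move: Y; apply: cy_ext => [||b] //.
  exact: (linearP ((g (cy a) \o f Z) \+ f (br (Z \ox cy a)) \+ (g Z \o g (cy a)))).
move: Z; apply: cy_ext => [||c] //.
  exact: (linearP ((g (cy a) \o g (cy b)) \+ (g (cy b) \o f (cy a))
    \+ f (br (cy a \ox cy b)))).
(* The [jacobi_r] part of each summand is minus the [jacobi_l] part of the cyclically next one, so
   the sum telescopes. *)
rewrite !br_brE !jacobi_cancel.
by rewrite !addrA !subrK subrr.
Qed.

(** * The cocycle condition *)

Lemma tmap_delta (f : {linear V -> V}) a :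
  tmap idfun f (delta (cy a)) + tmap f idfun (delta (cy a)) =
  cyclic_sum2 (fun z p w q =>
    pr z w *: wedge (f (cy (vx w :: q))) (cy (vx z :: p))) a.
Proof.
(* Renaming the points of the first term makes [f] act on the arc from w to z in both; the sign of
   the pairing then produces the wedge. *)
rewrite deltaE !linear_cyclic2 cyclic2_swap -cyclic2_add.
apply: eq_cyclic2 => z p w q.
by rewrite !linearZ /= !tmapE /= prC scaleNr addrC -scalerBr.
Qed.

(** The bracket contracts x in [a] with y in [b], and the cobracket contracts z with w in the joined
    word. The two sums have z and w both in [a] or both in [b]; the mixed terms cancel. *)
Lemma delta_brE a b : delta (br (cy a \ox cy b)) =
  cyclic_sum2 (fun z p w q => \split_(r, x, s <- q) cyclic_sum (fun y B =>
    (pr x y * pr z w) *: wedge (cy (vx w :: r ++ vx y :: B ++ vx x :: s))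
       (cy (vx z :: p))) b) a +
  cyclic_sum2 (fun z p w q => \split_(r, y, s <- q) cyclic_sum (fun x A =>
    (pr x y * pr z w) *: wedge (cy (vx w :: r ++ vx x :: A ++ vx y :: s))
       (cy (vx z :: p))) a) b.
Proof.
(* The terms whose second contraction joins the two words again; they cancel by
   exchanging the two contractions. *)
pose E (f : seq T -> seq T -> tensor V V) x u z v y u' w v' :=
  (pr x y * pr z w) *: f (vx w :: v' ++ vx x :: u) (vx z :: v ++ vx y :: u').
have EC : cyclic_sum2 (fun x u z v => cyclic_sum2 (fun y u' w v' =>
      E (fun s t => cy s \ox cy t) x u z v y u' w v') b) a =
    cyclic_sum2 (fun x u z v => cyclic_sum2 (fun y u' w v' =>
      E (fun s t => cy t \ox cy s) x u z v y u' w v') b) a.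
  rewrite cyclic2_swap; apply: eq_cyclic2 => x u z v.
  rewrite cyclic2_swap; apply: eq_cyclic2 => y u' w v'.
  by rewrite /E mulrC cy_swap [X in _ \ox X]cy_swap.
transitivity (cyclic_sum (fun x A => cyclic_sum (fun y B =>
  (\split_(u, z, v <- A) \split_(p, w, q <- v)
     (pr x y * pr z w) *: wedge (cy (vx w :: q ++ vx y :: B ++ vx x :: u))
       (cy (vx z :: p))) +
  (\split_(u, z, v <- B) \split_(p, w, q <- v)
     (pr x y * pr z w) *: wedge (cy (vx w :: q ++ vx x :: A ++ vx y :: u))
       (cy (vx z :: p))) +
  ((\split_(u, z, v <- A) \split_(u', w, v' <- B)
      E (fun s t => cy s \ox cy t) x u z v y u' w v') -
   (\split_(u, z, v <- A) \split_(u', w, v' <- B)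
      E (fun s t => cy t \ox cy s) x u z v y u' w v'))) b) a).
  rewrite brE linear_cyclic; apply: eq_cyclic => x A.
  rewrite linear_cyclic; apply: eq_cyclic => y B.
  rewrite linearZ /= deltaE cyclic2_cons2;
    try by move=> *; rewrite ?pr_vx ?pr_vxr scale0r.
  rewrite !scalerDr -split_sub !split_scale.
  congr (_ + _ + _); apply: eq_split => u z v _; rewrite -?split_sub split_scale;
    apply: eq_split => p w q _; rewrite (prC w z) scaleNr /E -?scalerBr scalerA //.

pose S F := cyclic_sum (fun x A => cyclic_sum (fun y B => F x A y B) b) a
  : tensor V V.
have SD F G : S (fun x A y B => F x A y B + G x A y B) = S F + S G.
  by rewrite -cyclic_add; apply: eq_cyclic => x A; exact: cyclic_add.
have SB F G : S (fun x A y B => F x A y B - G x A y B) = S F - S G.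
  by rewrite -cyclic_sub; apply: eq_cyclic => x A; exact: cyclic_sub.
have SE F : S (fun x A y B => \split_(u, z, v <- A) \split_(u', w, v' <- B)
      F x u z v y u' w v') =
    cyclic_sum2 (fun x u z v => cyclic_sum2 (fun y u' w v' =>
      F x u z v y u' w v') b) a.
  by apply: eq_cyclic => x A; rewrite cyclic_split_exchange.
rewrite -/(S (fun x A y B => _)) 2!SD SB !SE EC subrr addr0; congr (_ + _).
  (* The bracket reads the points x, z, w of [a] from x, the statement reads them from z. *)
  rewrite -(cyclic3_rot (fun x u z p w q => cyclic_sum (fun y B =>
    (pr x y * pr z w) *: wedge (cy (vx w :: q ++ vx y :: B ++ vx x :: u))
      (cy (vx z :: p))) b)).
  apply: eq_cyclic => x A; rewrite cyclic_split_exchange.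
  by apply: eq_split => u z v _; rewrite cyclic_split_exchange.
rewrite -(cyclic3_rot (fun y u z p w q => cyclic_sum (fun x A =>
    (pr x y * pr z w) *: wedge (cy (vx w :: q ++ vx x :: A ++ vx y :: u))
      (cy (vx z :: p))) a)).
rewrite /S cyclic_exchange; apply: eq_cyclic => y B; rewrite cyclic_split_exchange.
by apply: eq_split => u z v _; rewrite cyclic_split_exchange.
Qed.

(** The two sums of [delta_brE] are the two terms on the right: bracketing a factor of the cobracket
    with the other word only meets letters of its arc, since the vertex letter at the cut pairs to
    zero. *)
Lemma cocycle X Y :
  delta (br (X \ox Y)) = act_r br (delta X) Y + act_l br X (delta Y).
Proof.
move: X; apply: cy_ext => [|k X X'|a].
- move=> k U U'; exact: (linearP (delta \o lie_r br Y)).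
- rewrite linearP -[act_r br _ Y]/(act_rl br Y _) linearP.
  by rewrite [act_l br _ _](act_l_linear br (delta Y)) [in RHS]scalerDr addrACA.
move: Y; apply: cy_ext => [|k Y Y'|b].
- move=> k U U'; exact: (linearP (delta \o lie_l br (cy a))).
- rewrite [act_r br _ _]act_r_linear linearP act_l_linearr.
  by rewrite [in RHS]scalerDr addrACA.
rewrite delta_brE /act_r /act_l !tmap_delta; congr (_ + _).
  apply: eq_cyclic2 => z p w q; rewrite /= /lie_r brE.
  rewrite cyclic_cons => [|A]; last first.
    by apply: cyclic0 => y B; rewrite pr_vx scale0r.
  rewrite -/(wedgel _ _) linear_split split_scale; apply: eq_split => r x s _.
  rewrite linear_cyclic cyclic_scale; apply: eq_cyclic => y B.
  rewrite linearZ scalerA mulrC /=; congr (_ *: wedge _ _).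
  have := cyC (vx w :: r ++ vx y :: B) (vx x :: s); rewrite /= -!catA /= => ->.
  by rewrite -?catA.
apply: eq_cyclic2 => z p w q; rewrite /= /lie_l brE cyclic_exchange.
rewrite cyclic_cons => [|A]; last first.
  by apply: cyclic0 => x B; rewrite pr_vxr scale0r.
rewrite -/(wedgel _ _) linear_split split_scale; apply: eq_split => r y s _.
rewrite linear_cyclic cyclic_scale; apply: eq_cyclic => x A.
rewrite linearZ scalerA mulrC /=; congr (_ *: wedge _ _).
have := cyC (vx w :: r) (vx x :: A ++ vx y :: s); rewrite /= -!catA /= => ->.
by rewrite -?catA.
Qed.

(** * The co-Jacobi identity and the remaining axioms *)

Lemma cojacobi X : Alt (tmap delta idfun (delta X)) = 0.
Proof.
move: X; apply: cy_ext => [|k U U'|a].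
- exact: (linearP (@Alt K V \o tmap delta idfun \o delta)).
- by rewrite scaler0 addr0.
pose P z s : tensor (tensor V V) V := z \ox s.
(* The first cobracket contracts x and y, the second z and w in the arc from y to x, so the cyclic
   order is x, y, z, w. The arguments of [f] are the three words left over, the first one joining
   two arcs. *)
pose F (f : V -> V -> V -> tensor (tensor V V) V) x p y r z s w u :=
  (pr x y * pr z w) *: Alt (f (cy (vx w :: u ++ vx y :: r)) (cy (vx z :: s))
    (cy (vx x :: p))).
pose S F := cyclic_sum2 (fun x p y B => \split_(r, z, C <- B)
    \split_(s, w, u <- C) F x p y r z s w u) a : tensor (tensor V V) V.
transitivity (S (F (fun M N P => M \ox N \ox P)) -
              S (F (fun M N P => N \ox M \ox P))).
  rewrite /S -cyclic2_sub deltaE !linear_cyclic2.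
  apply: eq_cyclic2 => x p y q.
  rewrite !linearZ /= tmapE deltaE.
  rewrite cyclic2_cons => [|*|*]; rewrite ?pr_vx ?pr_vxr ?scale0r //=.
  rewrite -split_sub -/(tpurel _ _) 2!linear_split split_scale.
  apply: eq_split => r z C _; rewrite -split_sub 2!linear_split split_scale.
  apply: eq_split => s w u _; rewrite /F.
  rewrite (prC w z) scaleNr -scalerBr 2!linearZ scalerA.
  by rewrite -[in RHS]scalerBr 2!linearB.
suff -> : S (F (fun M N P => M \ox N \ox P)) = S (F (fun M N P => N \ox M \ox P)).
  by rewrite subrr.
(* Rotating by two points exchanges the two contractions: M is preserved up to rotation, while N and
   P trade places. *)
rewrite /S cyclic4_rot; apply: eq_cyclic2 => x p y B.
do 2![apply: eq_split => ? ? ? _]; rewrite /F mulrC; congr (_ *: _).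
(* The tensors M, P, N and N, M, P differ by a cyclic permutation of the factors, hence have the
   same [Alt]. *)
rewrite cy_swap !AltE. by rewrite addrC addrA.
Qed.

(** The two orders of a pair of points give opposite coefficients and exchanged factors, that is, a
    multiple of a wedge. *)
Lemma delta_wedge X :
  Defs.span (fun t => exists y z, t = wedge y z) (delta X).
Proof.
elim: (cy_span X) => [|k _ Y [w ->] _ IH]; first by rewrite linear0; constructor.
rewrite linearP; apply: span_add => //; apply: span_scale.
rewrite deltaE cyclic2E; apply: big_ind => [|s t|[[u x] v] _ /=].
- exact: span0.
- exact: span_add.
apply: big_ind => [|s t|[[p y] q] _ /=].
- exact: span0.
- exact: span_add.
rewrite (prC y x) scaleNr -scalerBr; apply: span_scale; apply: span_incl.
by do 2!eexists.
Qed.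

Lemma formal_lie_bialgebra : 2 != 0 :> K -> lie_bialgebra br delta.
Proof.
move=> two_neq0; split; last exact: cocycle.
- split=> [X|]; last exact: br_jacobi.
  (* Antisymmetry gives twice the bracket equal to zero, and 2 is invertible. *)
  have /eqP := br_antisym X X; rewrite -subr_eq0 opprK -mulr2n -scaler_nat.
  by rewrite scaler_eq0 (negPf two_neq0) => /eqP.
- exact: delta_wedge.
- exact: cojacobi.
Qed.

End FormalNecklaces.

(** * From the indexed sums of the defining formulas to splittings *)

Section TnthSplit.
Variables (T : Type) (W : nmodType).

Lemma tnth_lift (a : T) w (i : 'I_(size w)) :
  tnth (in_tuple (a :: w)) (lift ord0 i) = tnth (in_tuple w) i.
Proof. by rewrite !(tnth_nth a). Qed.

Lemma sum_tnth_split (F : seq T -> T -> seq T -> W) w :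
  \sum_(i < size w) F (take i w) (tnth (in_tuple w) i) (drop i.+1 w) =
  split_sum F w.
Proof.
elim: w F => [|a w IH] F; first by rewrite big_ord0 split_nil.
rewrite big_ord_recl split_cons /= drop0 (tnth_nth a) -IH; congr (_ + _).
by apply: eq_bigr => i _; rewrite tnth_lift.
Qed.

Lemma sum_tnth_split2 (F : seq T -> T -> seq T -> T -> seq T -> W) w :
  \sum_(i < size w) \sum_(j < size w | (i < j)%N)
    F (take i w) (tnth (in_tuple w) i) (drop i.+1 (take j w))
      (tnth (in_tuple w) j) (drop j.+1 w) =
  \split_(u, x, v <- w) \split_(p, y, q <- v) F u x p y q.
Proof.
elim: w F => [|a w IH] F; first by rewrite big_ord0 split_nil.
rewrite big_ord_recl split_cons -IH -sum_tnth_split; congr (_ + _).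
  rewrite big_mkcond big_ord_recl /= add0r; apply: eq_bigr => j _ /=.
  by rewrite tnth_lift (tnth_nth a) drop0.
apply: eq_bigr => i _; rewrite big_mkcond big_ord_recl /= add0r [RHS]big_mkcond.
by apply: eq_bigr => j _; rewrite !tnth_lift.
Qed.

End TnthSplit.

Lemma malg_span (K : fieldType) (T : choiceType) (x : {malg K[T]}) :
  Defs.span (fun z => exists k, z = << k >>) x.
Proof.
rewrite (monalgE x); apply: big_ind => [|y z|k _].
- exact: span0.
- exact: span_add.
have -> : << x@_k *g k >> = x@_k *: << k >>.
  by apply/malgP => j; rewrite mcoeffZ !mcoeffU mulrnAr mulr1.
by apply/span_scale/span_incl; exists k.
Qed.

(** * Words in edges and vertices, and their classes in L *)

Section Letters.
Variables (K : fieldType) (Q : quiver).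

Definition letter : choiceType := (edge Q + vertex Q)%type.

Definition letter_src (a : letter) : vertex Q :=
  match a with inl e => edge_src e | inr v => v end.

Definition letter_tgt (a : letter) : vertex Q :=
  match a with inl e => edge_tgt e | inr v => v end.

Definition letter_pairing (a b : letter) : K :=
  match a, b with inl e, inl f => edge_pairing K e f | _, _ => 0 end.

Definition tgt_letter (a : letter) : letter := inr (letter_tgt a).

Definition composable (a b : letter) : bool := letter_tgt a == letter_src b.

Definition edge_of (a : letter) : option (edge Q) :=
  match a with inl e => Some e | inr _ => None end.

Definition edges (w : seq letter) : seq (edge Q) := pmap edge_of w.

(** The empty word has no base vertex and is sent to 0; the trivial path at v is the one-letter word
    [[:: inr v]]. *)
Definition cyclic_word (w : seq letter) : necklaces K Q :=
  if w is a :: _ then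
    if cycle composable w then cyc K (letter_src a) (edges w) else 0
  else 0.

Lemma edges_cat u v : edges (u ++ v) = edges u ++ edges v.
Proof. exact: pmap_cat. Qed.

Lemma edges_tgt x w : edges (tgt_letter x :: w) = edges w.
Proof. by []. Qed.

Lemma split_edges (W : nmodType)
    (F : seq (edge Q) -> edge Q -> seq (edge Q) -> W) w :
  split_sum F (edges w) = \split_(u, x, v <- w)
    if x is inl e then F (edges u) e (edges v) else 0.
Proof.
elim: w F => [|[e|v] w IH] F; first by rewrite !split_nil.
  by rewrite /= !split_cons IH.
by rewrite split_cons add0r -IH.
Qed.

Lemma path_walk a w : path composable a w ->
  is_walk (letter_src a) (edges (a :: w)) /\
  last (letter_src a) (map (@edge_tgt Q) (edges (a :: w))) =
    letter_tgt (last a w).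
Proof.
have tgtP b s : path composable b s ->
    is_walk (letter_tgt b) (edges s) /\
    last (letter_tgt b) (map (@edge_tgt Q) (edges s)) = letter_tgt (last b s).
  elim: s b => //= -[e|v] s IH b /andP[/eqP bE /IH[sw sl]] /=.
    by rewrite bE eqxx.
  by rewrite bE.
move/tgtP => [ww wl]; case: a ww wl => [e|v] //= ww wl.
by rewrite eqxx.
Qed.

Lemma cycle_closed_walk a w : cycle composable (a :: w) ->
  closed_walk (letter_src a) (edges (a :: w)).
Proof.
rewrite /cycle rcons_path => /andP[/path_walk[ww wl] /eqP wa].
by rewrite /closed_walk ww wl wa eqxx.
Qed.

Lemma lpi_qpath_mulC (p q : qpath Q) :
  lpi (@path_comm K Q) (qpath_mul K p q) = lpi (@path_comm K Q) (qpath_mul K q p).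
Proof.
apply/eqP; rewrite -subr_eq0 -linearB; apply/eqP/lpi0.
have mulE (r s : qpath Q) : qpath_mul K r s = path_mul << r >> << s >>.
  by rewrite /path_mul !mliftU.
exists << p >>, << q >>; congr (_ - _); exact: mulE.
Qed.

(** The two words are the products, in either order, of a path from v to u and a path back; they
    differ by a commutator. *)
Lemma cyc_rot v u (w1 w2 : seq (edge Q)) :
  is_walk v w1 -> last v (map (@edge_tgt Q) w1) = u ->
  is_walk u w2 -> last u (map (@edge_tgt Q) w2) = v ->
  cyc K v (w1 ++ w2) = cyc K u (w2 ++ w1).
Proof.
move=> vw vu uw uv.
have [p [_ ps pw]] := walkE K vw; have [q [_ qs qw]] := walkE K uw.
have := lpi_qpath_mulC p q.
by rewrite /qpath_mul /path_tgt ps qs pw qw vu uv !eqxx.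
Qed.

Lemma cyclic_word_catC u v : cyclic_word (u ++ v) = cyclic_word (v ++ u).
Proof.
case: u => [|a u]; first by rewrite cats0.
case: v => [|b v]; first by rewrite cats0.
rewrite /cyclic_word !cat_cons -!cat_cons cycle_catC; case: ifP => //.
rewrite -[_ ++ _ :: _]/((b :: v) ++ a :: u) !edges_cat.
rewrite /= rcons_path cat_path last_cat /=.
case/andP=> /and3P[/path_walk[au ua] /eqP ab /path_walk[bv vb]] /eqP ba.
by apply: cyc_rot; rewrite // ?ua ?vb.
Qed.

Lemma cyclic_word_span X :
  Defs.span (fun c => exists w, c = cyclic_word w) X.
Proof.
have [x ->] := lpi_surj X.
elim: (malg_span x) => [|c _ y [p ->] _ IH]; first by rewrite linear0; exact: span0.
rewrite linearP; apply: span_add => //; apply: span_scale.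
have [pc|pNc] := boolP (closed_path p); last first.
  (* For the trivial path e at the source of a non-closed path p, ep = p and pe = 0, so p is a
     commutator. *)
  have [e [_ es ew]] := @walkE K Q (path_src p) [::] isT.
  have := lpi_qpath_mulC e p; rewrite /qpath_mul {1}/path_tgt es ew /= eqxx.
  rewrite walk_qpath [path_tgt p == _](negPf pNc) linear0 => ->.
  exact: span0.
(* The leading vertex letter keeps the word nonempty when the path is trivial. *)
apply: span_incl; exists (inr (path_src p) :: map inl (path_word p)).
have wE s : edges (map inl s) = s by apply: map_pK.
suff pcyc : cycle composable
    ((inr (path_src p) :: map inl (path_word p)) : seq letter).
  by rewrite /cyclic_word pcyc /= wE /cyc walk_qpath.
have walk_path (b : letter) s : is_walk (letter_tgt b) s ->
    path composable b (map inl s) /\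
    letter_tgt (last b (map inl s)) = last (letter_tgt b) (map (@edge_tgt Q) s).
  elim: s b => [|e s IHs] b //= /andP[/eqP eb sw].
  by rewrite /composable /= eb eqxx; apply: (IHs (inl e)).
have [pp pl] := walk_path (inr (path_src p)) _ (valP p).
by rewrite /= rcons_path pp /composable pl /=; exact: pc.
Qed.

(** * Pairing of letters and composability *)

Lemma letter_pairingC a b : letter_pairing a b = - letter_pairing b a.
Proof.
by case: a b => [e|v] [f|u] /=; rewrite ?oppr0 // edge_pairingC.
Qed.

(** A nonzero pairing forces the letters to be e and e^* for some edge e. *)
Lemma pairing_ends a b : letter_pairing a b != 0 ->
  letter_src a = letter_tgt b /\ letter_src b = letter_tgt a.
Proof.
case: a b => [[e|e]|v] [[f|f]|u] /=; rewrite ?oppr_eq0 ?eqxx //.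
  by case: (eqVneq e f) => [->|_] //; rewrite mulr0n eqxx.
by case: (eqVneq e f) => [->|_] //; rewrite mulr0n eqxx.
Qed.

Lemma path_tgt_letter x s :
  path composable (tgt_letter x) s = path composable x s.
Proof. by case: s. Qed.

Lemma composable_last_tgt x s b :
  composable (last (tgt_letter x) s) b = composable (last x s) b.
Proof. by case: s. Qed.

Lemma composable_tgt_letter a x y : letter_pairing x y != 0 ->
  composable a (tgt_letter y) = composable a x.
Proof. by case/pairing_ends=> xy _; rewrite /composable xy. Qed.

(** As x and y are opposite edges, the target of each is the source of the other, so each vertex
    letter imposes the junctions of the edge it replaces. Thus a contraction of non-composable words
    is non-composable. *)
Lemma cycle_join x A y B : letter_pairing x y != 0 ->
  cycle composable (tgt_letter x :: A ++ tgt_letter y :: B) =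
  cycle composable (x :: A) && cycle composable (y :: B).
Proof.
move=> xy; have yx : letter_pairing y x != 0 by rewrite letter_pairingC oppr_eq0.
rewrite /= rcons_cat cat_path /= !rcons_path !path_tgt_letter !composable_last_tgt.
by rewrite (composable_tgt_letter _ xy) (composable_tgt_letter _ yx) !andbA.
Qed.

Lemma cycle_cut x p y B : letter_pairing x y != 0 ->
  cycle composable (x :: p ++ y :: B) =
  cycle composable (tgt_letter x :: p) && cycle composable (tgt_letter y :: B).
Proof.
move=> xy; have yx : letter_pairing y x != 0 by rewrite letter_pairingC oppr_eq0.
rewrite /= rcons_cat cat_path /= !rcons_path !path_tgt_letter !composable_last_tgt.
by rewrite (composable_tgt_letter _ xy) (composable_tgt_letter _ yx) !andbA.
Qed.

Lemma cyclic_wordE a w : cycle composable (a :: w) ->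
  cyclic_word (a :: w) = cyc K (letter_src a) (edges (a :: w)).
Proof. by rewrite /cyclic_word => ->. Qed.

Lemma cyclic_word0 w : ~~ cycle composable w -> cyclic_word w = 0.
Proof. by case: w => // a w /negPf; rewrite /cyclic_word => ->. Qed.

(** * The defining formulas on arbitrary words *)

Lemma bracket_cyclic_word a b :
  bracket (cyclic_word a \ox cyclic_word b) =
  cyclic_sum (fun x A => cyclic_sum (fun y B => letter_pairing x y *:
    cyclic_word (tgt_letter x :: A ++ tgt_letter y :: B)) b) a.
Proof.
have termE u x v u' y v' : letter_pairing x y *:
    cyclic_word (tgt_letter x :: (v ++ u) ++ tgt_letter y :: v' ++ u') =
    if cycle composable (u ++ x :: v) && cycle composable (u' ++ y :: v') then
      letter_pairing x y *: cyc K (letter_tgt x) (edges (v ++ u ++ v' ++ u'))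
    else 0.
  have [->|xy] := eqVneq (letter_pairing x y) 0; first by rewrite !scale0r if_same.
  rewrite ![cycle _ (_ ++ _ :: _)]cycle_catC !cat_cons -(cycle_join _ _ xy).
  case: ifP => [c|/negbT c]; last by rewrite cyclic_word0 ?scaler0.
  rewrite cyclic_wordE //; congr (_ *: cyc _ _ _).
  by rewrite -cat_cons edges_cat !edges_tgt -edges_cat -catA.
(* Both sides reduce to the defining formula on the underlying edges, set to 0 unless both words are
   composable. *)
transitivity (if cycle composable a && cycle composable b
  then word_bracket K (edges a) (edges b) else 0); last first.
  rewrite /word_bracket /=.
  under eq_bigr => i _ do rewrite (sum_tnth_split (fun u y v =>
    edge_pairing K (tnth (in_tuple (edges a)) i) y *:
      cyc K (edge_tgt (tnth (in_tuple (edges a)) i))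
        (drop i.+1 (edges a) ++ take i (edges a) ++ v ++ u))).
  rewrite (sum_tnth_split (fun u x v => \split_(u', y, v' <- edges b)
    (edge_pairing K x y *: cyc K (edge_tgt x) (v ++ u ++ v' ++ u')))).
  rewrite split_edges /cyclic_sum.
  (* The equations [ax] and [by'] turn the condition of [termE] into one on [a] and [b], constant
     over the sum. *)
  under [RHS]eq_split => u x v ax.
    under eq_split => u' y v' by' do rewrite termE -ax -by'.
    over.
  case: ifP => _; last first.
    by rewrite [RHS]big1 // => s _; apply: big1.
  apply: eq_split => u [e|w] v _; last first.
    by rewrite [RHS]big1 // => s _; rewrite scale0r.
  rewrite split_edges; apply: eq_split => u' [f|w] v' _ /=; last by rewrite scale0r.
  by rewrite !edges_cat.
have br0l X : bracket (0 \ox X) = 0 :> necklaces K Q :=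
  linear0 (lie_r (@bracket K Q) X).
have br0r X : bracket (X \ox 0) = 0 :> necklaces K Q :=
  linear0 (lie_l (@bracket K Q) X).
case: ifP => [/andP[]|/negbT]; last first.
  by rewrite negb_and => /orP[] /cyclic_word0 ->.
(* The empty word passes the test [cycle] but is sent to 0; the corresponding sums are empty. *)
case: a => [|x A] ca; first by rewrite br0l /word_bracket big_ord0.
case: b => [|y B] cb; first
  by rewrite br0r /word_bracket big1 // => i _; rewrite big_ord0.
by rewrite !cyclic_wordE // bracketE //; exact: cycle_closed_walk.
Qed.

(** [cyclic2E] groups the ordered pairs of positions into the pairs i < j of the definition, and
    antisymmetry of the pairing turns the two tensors of a group into the wedge. *)
Lemma cobracket_cyclic_word a :
  cobracket (cyclic_word a) =
  cyclic_sum2 (fun x p y q => letter_pairing x y *: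
    (cyclic_word (tgt_letter y :: q) \ox cyclic_word (tgt_letter x :: p))) a.
Proof.
have termE u x p y q : letter_pairing x y *:
    wedge (cyclic_word (tgt_letter y :: q ++ u)) (cyclic_word (tgt_letter x :: p)) =
    if cycle composable (u ++ x :: p ++ y :: q) then letter_pairing x y *:
      wedge (cyc K (letter_tgt y) (edges (q ++ u))) (cyc K (letter_tgt x) (edges p))
    else 0.
  have [->|xy] := eqVneq (letter_pairing x y) 0; first by rewrite !scale0r if_same.
  rewrite cycle_catC cat_cons -catA cat_cons (cycle_cut _ _ xy).
  have [cp|/cyclic_word0 ->] := boolP (cycle composable (tgt_letter x :: p));
    last first.
    by rewrite wedge0r scaler0.
  have [cq|/cyclic_word0 ->] := boolP (cycle composable (tgt_letter y :: q ++ u)).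
    by rewrite !cyclic_wordE.
  by rewrite wedge0l scaler0.
transitivity (if cycle composable a then word_cobracket K (edges a) else 0).
  case: ifP => [|/negbT/cyclic_word0->]; last exact: linear0.
  case: a => [|x A] ca; first by rewrite /word_cobracket big_ord0; exact: linear0.
  by rewrite cyclic_wordE // (cobracketE _ (cycle_closed_walk ca)).
rewrite /word_cobracket /= (sum_tnth_split2 (fun u x p y q => edge_pairing K x y *:
  wedge (cyc K (edge_tgt y) (q ++ u)) (cyc K (edge_tgt x) p))) cyclic2E.
under [RHS]eq_split => u x v ax.
  under eq_split => p y q vy do
    rewrite (letter_pairingC y x) scaleNr -scalerBr termE -vy -ax.
  over.
case: ifP => _; last by rewrite [RHS]big1 // => s _; apply: big1.
rewrite split_edges; apply: eq_split => u [e|w] v _; last first.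
  by rewrite [RHS]big1 // => s _; rewrite scale0r.
rewrite split_edges; apply: eq_split => p [f|w] q _ /=; last by rewrite scale0r.
by rewrite !edges_cat.
Qed.

Lemma necklace_lie_bialgebra :
  2 != 0 :> K -> lie_bialgebra (@bracket K Q) (@cobracket K Q).
Proof.
apply: (formal_lie_bialgebra (pr := letter_pairing) (vx := tgt_letter)
  (cy := cyclic_word)).
- exact: letter_pairingC.
- by [].
- exact: cyclic_word_catC.
- exact: cyclic_word_span.
- exact: bracket_cyclic_word.
- exact: cobracket_cyclic_word.
Qed.

End Letters.

Theorem mainTheorem1 (R : realType) (Q : quiver) :
  lie_bialgebra (@bracket (complex R) Q) (@cobracket (complex R) Q).
Proof. by apply: necklace_lie_bialgebra; rewrite Num.Theory.pnatr_eq0. Qed.
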